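(* Let $\mathcal X=[\mathbf b_\ell,\mathbf b_u]\subset\mathbb R^n$ be a hyperrectangle, $c$ an integrable real-valued function on $\mathcal X$, $\beta>0$, and define $$c^\beta(\mathbf x)=\mathbb E_{\mathbf u}[c(\mathbf x+\beta\mathbf u)],\qquad \mathbf u\sim\mathcal{TN}\Big(\mathbf 0,\mathbf I,\tfrac{\mathbf b_\ell-\mathbf x}{\beta},\tfrac{\mathbf b_u-\mathbf x}{\beta}\Big).$$ Then the following hold. 1. $c^\beta$ is infinitely differentiable: $c^\beta\in\mathcal C^\infty$. 2. A one-sided unbiased estimator of $\nabla c^\beta$ is $$\tilde\nabla c^\beta(\mathbf x)=\frac{(\mathbf u-\boldsymbol\mu)c(\mathbf x+\beta\mathbf u)-(\mathbf u-\boldsymbol\mu)c(\mathbf x)}{\beta},$$ i.e. $\mathbb E_{\mathbf u}[\tilde\nabla c^\beta(\mathbf x)]=\nabla c^\beta(\mathbf x)$, where $\boldsymbol\mu$ is the mean of the truncated Gaussian vector $\mathbf u$, namely $$\mu_i=\frac{\phi\big(\frac{b_{\ell_i}-x_i}{\beta}\big)-\phi\big(\frac{b_{u_i}-x_i}{\beta}\big)}{\Phi\big(\frac{b_{u_i}-x_i}{\beta}\big)-\Phi\big(\frac{b_{\ell_i}-x_i}{\beta}\big)},\qquad i\in\{1,\dots,n\}.$$ 3. Let $\mathbf u_1\sim\mathcal{TN}(\mathbf 0,\mathbf I,\frac{\mathbf b_\ell-\mathbf x}{\beta},\frac{\mathbf b_u-\mathbf x}{\beta})$ and $\mathbf u_2\sim\mathcal{TN}(\mathbf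 0,\mathbf I,\frac{\mathbf x-\mathbf b_u}{\beta},\frac{\mathbf x-\mathbf b_\ell}{\beta})$, with means $\boldsymbol\mu_1$ and $\boldsymbol\mu_2$. A two-sided unbiased estimator of $\nabla c^\beta$ is $$\tilde\nabla c^\beta(\mathbf x)=\frac{(\mathbf u_1-\boldsymbol\mu_1)(c(\mathbf x+\beta\mathbf u_1)-c(\mathbf x))-(\mathbf u_2-\boldsymbol\mu_2)(c(\mathbf x-\beta\mathbf u_2)-c(\mathbf x))}{2\beta}.$$ 4. If in addition $c$ is $L$-Lipschitz continuous, then for all $\mathbf x\in\mathcal X$, $\ |c^\beta(\mathbf x)-c(\mathbf x)|\le L\beta\sqrt n$.
   Context: $\mathcal{TN}(\mathbf 0,\mathbf I,\mathbf a,\mathbf b)$ denotes the standard Gaussian distribution $\mathcal N(\mathbf 0,\mathbf I)$ on $\mathbb R^n$ truncated to (conditioned on) the box $[\mathbf a,\mathbf b]$; its coordinates are independent. Thus $\mathbf x+\beta\mathbf u$ always lies in $\mathcal X$. $\phi$ and $\Phi$ denote respectively the probability density function and the cumulative distribution function of the one-dimensional standard Gaussian distribution. *)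

(* Defs.v *)
From HB Require Import structures.
From mathcomp Require Import all_boot all_order all_algebra.
From mathcomp Require Import all_classical all_reals all_analysis.

Set Implicit Arguments.
Unset Strict Implicit.
Unset Printing Implicit Defensive.

Import Order.TTheory GRing.Theory Num.Theory.
Import numFieldNormedType.Exports.

Local Open Scope classical_set_scope.
Local Open Scope ring_scope.

(* The product sigma-algebra on R^n, generated by the coordinates; it is
   the Borel sigma-algebra of R^n. *)
Definition measure_rV_display : measure_display.
Proof. exact: default_measure_display. Qed.

Section measurable_rV.
Context {R : realType}.
Variable n : nat.

Let coor : 'I_n -> 'rV[R]_n -> measurableTypeR R := fun i x => x ord0 i.

Let rV_set0 : g_sigma_preimage coor set0.
Proof. exact: sigma_algebra0. Qed.

Let rV_setC A : g_sigma_preimage coor A -> g_sigma_preimage coor (~` A).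
Proof. exact: sigma_algebraC. Qed.

Let rV_bigcup (F : _^nat) : (forall i, g_sigma_preimage coor (F i)) ->
  g_sigma_preimage coor (\bigcup_i (F i)).
Proof. exact: sigma_algebra_bigcup. Qed.

HB.instance Definition _ := @isMeasurable.Build measure_rV_display
  'rV[R]_n (g_sigma_preimage coor) rV_set0 rV_setC rV_bigcup.

End measurable_rV.

Section rV_coordinates.
Context {R : realType}.
Implicit Type n : nat.

Lemma measurable_coord n (i : 'I_n) :
  measurable_fun [set: 'rV[R]_n]
    (fun x : 'rV[R]_n => x ord0 i : measurableTypeR R).
Proof.
move=> _ Y mY; rewrite setTI; apply: sub_sigma_algebra => /=.
rewrite -bigcup_seq/=; exists i => /=; first by rewrite mem_index_enum.
by exists Y => //; rewrite setTI.
Qed.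

Lemma measurable_fun_coordP d (T : measurableType d) n (f : T -> 'rV[R]_n) :
  measurable_fun [set: T] f <->
  forall i, measurable_fun [set: T] (fun x => f x ord0 i : measurableTypeR R).
Proof.
split=> [mf i|mf].
  by apply: (measurableT_comp (@measurable_coord n i)).
move=> _ Y; rewrite setTI.
pose G := [set A : set 'rV[R]_n | measurable (f @^-1` A)].
suff : @measurable _ 'rV[R]_n `<=` G by apply.
apply: smallest_sub.
  split => [|A mA|F mF]; rewrite /G /=.
  - by rewrite preimage_set0.
  - by rewrite setTD preimage_setC; exact: measurableC.
  - by rewrite preimage_bigcup; apply: bigcup_measurable => k _; exact: mF.
rewrite -bigcup_seq; apply: bigcup_sub => i _ A [B mB BA].
by rewrite -BA /G /= setTI -[X in measurable X]setTI; exact: mf.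
Qed.

Definition cons_rV n (p : measurableTypeR R * 'rV[R]_n) : 'rV[R]_n.+1 :=
  \row_(i < n.+1) oapp (fun j => p.2 ord0 j) p.1 (unlift ord0 i).

Definition uncons_rV n (v : 'rV[R]_n.+1) : measurableTypeR R * 'rV[R]_n :=
  (v ord0 ord0, \row_(j < n) v ord0 (lift ord0 j)).

Lemma cons_rVK n : cancel (@cons_rV n) (@uncons_rV n).
Proof.
move=> [t v]; rewrite /uncons_rV /cons_rV mxE unlift_none /=; congr pair.
by apply/rowP => j; rewrite !mxE liftK.
Qed.

Lemma uncons_rVK n : cancel (@uncons_rV n) (@cons_rV n).
Proof.
move=> v; apply/rowP => i; rewrite mxE.
by case: unliftP => [j|] -> //=; rewrite mxE.
Qed.

Lemma measurable_cons_rV n : measurable_fun setT (@cons_rV n).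
Proof.
apply/measurable_fun_coordP => i.
under eq_fun do rewrite mxE.
case: (unliftP ord0 i) => [j _|_] /=; last exact: measurable_fst.
exact: (measurableT_comp (@measurable_coord n j) measurable_snd).
Qed.

Lemma measurable_uncons_rV n : measurable_fun setT (@uncons_rV n).
Proof.
apply/measurable_fun_pairP; split; first exact: measurable_coord.
apply/measurable_fun_coordP => j /=.
rewrite (_ : (fun _ => _) = fun x : 'rV[R]_n.+1 => x ord0 (lift ord0 j)).
  exact: measurable_coord.
by apply/funext => x; rewrite /= mxE.
Qed.

End rV_coordinates.

Section power_measure.
Context {R : realType}.
Local Open Scope ereal_scope.

Section step.
Variables (mu : {sigma_finite_measure set (measurableTypeR R) -> \bar R}) (n : nat).
Variable nu : {sigma_finite_measure set 'rV[R]_n -> \bar R}.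

Definition cons_measure := pushforward (mu \x nu) (@cons_rV R n).

Let cons_measure0 : cons_measure set0 = 0.
Proof. by rewrite /cons_measure /pushforward preimage_set0 measure0. Qed.

Let cons_measure_ge0 A : 0 <= cons_measure A.
Proof. exact: (measure_ge0 (mu \x nu)). Qed.

Let cons_measure_sigma_additive : semi_sigma_additive cons_measure.
Proof.
exact: (@measure_semi_sigma_additive _ _ _
  (measure_function_pushforward__canonical__measure_function_Measure
    (mu \x nu) (@measurable_cons_rV R n))).
Qed.

HB.instance Definition _ := isMeasure.Build _ _ _ cons_measure
  cons_measure0 cons_measure_ge0 cons_measure_sigma_additive.

Let cons_measure_sigma_finite : sigma_finite setT cons_measure.
Proof.
have /sigma_finiteP[F [FT ndF Foo]] := sigma_finiteT mu.
have /sigma_finiteP[G [GT ndG Goo]] := sigma_finiteT nu.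
exists (fun k => @uncons_rV R n @^-1` (F k `*` G k)) => [|k].
  rewrite -preimage_bigcup (_ : \bigcup_k (F k `*` G k) = setT) //.
  rewrite -setXTT FT GT predeqE => -[x y]; split=> [[k _ []/= Fx Gy]|].
    by split; exists k.
  move=> [/= [k _ Fkx] [l _ Gly]]; exists (maxn k l) => //; split.
  - by move: x Fkx; exact/subsetPset/ndF/leq_maxl.
  - by move: y Gly; exact/subsetPset/ndG/leq_maxr.
have [mFk Fk] := Foo k; have [mGk Gk] := Goo k; split.
  rewrite -[X in measurable X]setTI; apply: measurable_uncons_rV => //.
  exact: measurableX.
rewrite /cons_measure /pushforward -comp_preimage.
rewrite (_ : _ \o _ = id); last by apply/funext => x /=; rewrite cons_rVK.
by rewrite preimage_id product_measure1E// lte_mul_pinfty// ge0_fin_numE.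
Qed.

HB.instance Definition _ := Measure_isSigmaFinite.Build _ _ _ cons_measure
  cons_measure_sigma_finite.

End step.

(* The n-fold product of mu with itself, as a measure on R^n. *)
Fixpoint power_measure (mu : {sigma_finite_measure set (measurableTypeR R) -> \bar R}) n :
    {sigma_finite_measure set 'rV[R]_n -> \bar R} :=
  if n is m.+1 then cons_measure mu (power_measure mu m)
  else dirac (0%R : 'rV[R]_0).

End power_measure.

Section truncated_gaussian.
Context {R : realType}.
Implicit Type n : nat.
Local Open Scope ereal_scope.

Definition lebesgue_rV n : {sigma_finite_measure set 'rV[R]_n -> \bar R} :=
  power_measure (@lebesgue_measure R) n.

Definition std_gaussian n : {sigma_finite_measure set 'rV[R]_n -> \bar R} :=
  power_measure (normal_prob (0%R : R) 1%R) n.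

Definition box n (a b : 'rV[R]_n) : set 'rV[R]_n :=
  [set x | forall i, (a ord0 i <= x ord0 i <= b ord0 i)%R].

Lemma measurable_box n (a b : 'rV[R]_n) : measurable (box a b).
Proof.
rewrite (_ : box a b = \big[setI/setT]_(i < n)
    ((fun x : 'rV[R]_n => x ord0 i : measurableTypeR R) @^-1`
      `[a ord0 i, b ord0 i])).
  apply: bigsetI_measurable => i _; rewrite -[X in measurable X]setTI.
  by apply: measurable_coord => //; exact: measurable_itv.
apply/seteqP; split=> [x abx|x].
  by rewrite -bigcap_seq => i _; rewrite /= in_itv /=; exact: abx.
rewrite -bigcap_seq => abx i.
by have /= := abx i (mem_index_enum i); rewrite in_itv.
Qed.

(* Standard Gaussian distribution conditioned on the box [a, b]. *)
Definition truncated_gaussian n (a b : 'rV[R]_n) (A : set 'rV[R]_n) : \bar R :=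
  ((fine (std_gaussian n (box a b)))^-1)%:E *
  std_gaussian n (A `&` box a b).

Lemma truncated_gaussian_weight_ge0 n (a b : 'rV[R]_n) :
  (0 <= (fine (std_gaussian n (box a b)))^-1)%R.
Proof. by rewrite invr_ge0 fine_ge0. Qed.

HB.instance Definition _ n (a b : 'rV[R]_n) :=
  Measure.copy (truncated_gaussian a b)
    (mscale (NngNum (truncated_gaussian_weight_ge0 a b))
      (mrestr (std_gaussian n) (measurable_box a b))).

(* The support condition is required everywhere, and not only almost surely,
   so that c (x + beta *: u w) is determined by the values of c on its domain. *)
Definition has_truncated_gaussian_law d (W : measurableType d)
    (P : probability W R) n (u : {RV P >-> 'rV[R]_n}) (a b : 'rV[R]_n) : Prop :=
  (forall w, box a b (u w)) /\
  (forall A, measurable A -> distribution P u A = truncated_gaussian a b A).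

(* The random vector G is integrable with E[G] = m, coordinatewise. *)
Definition has_mean d (W : measurableType d) (P : probability W R) n
    (G : W -> 'rV[R]_n) (m : 'rV[R]_n) : Prop :=
  forall i, P.-integrable setT (fun w => (G w ord0 i)%:E) /\
            'E_P[fun w => G w ord0 i] = (m ord0 i)%:E.

Definition phi (t : R) : R := normal_pdf 0 1 t.

Definition Phi (t : R) : R := fine (normal_prob 0%R 1%R `]-oo, t]%classic).

Definition truncated_gaussian_mean n (a b : 'rV[R]_n) : 'rV[R]_n :=
  (\row_i ((phi (a ord0 i) - phi (b ord0 i)) /
           (Phi (b ord0 i) - Phi (a ord0 i))))%R.

End truncated_gaussian.

Section calculus.
Context {R : realType} {n : nat}.

Definition partial (i : 'I_n) (f : 'rV[R]_n -> R) : 'rV[R]_n -> R :=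
  fun x => 'D_(delta_mx ord0 i) f x.

Definition gradient (f : 'rV[R]_n -> R) (x : 'rV[R]_n) : 'rV[R]_n :=
  \row_i partial i f x.

Fixpoint class_C (k : nat) (f : 'rV[R]_n -> R) : Prop :=
  continuous f /\
  (if k is k'.+1 then
     forall i, (forall x, derivable f x (delta_mx ord0 i)) /\
               class_C k' (partial i f)
   else True).

Definition smooth (f : 'rV[R]_n -> R) : Prop := forall k, class_C k f.

(* The canonical norm of 'rV[R]_n is the sup norm. *)
Definition norm2 (v : 'rV[R]_n) : R := Num.sqrt (\sum_i v ord0 i ^+ 2).

Definition lipschitz_norm2 (L : R) (X : set 'rV[R]_n) (f : 'rV[R]_n -> R) :
    Prop :=
  forall x y, X x -> X y -> `|f x - f y| <= L * norm2 (x - y).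

End calculus.

(* c^beta; the integral runs over the truncation box, which carries the whole
   mass of the law, so that only the values of c on [bl, bu] matter. The
   expression makes sense for every x in R^n, not only for x in [bl, bu]. *)
Definition smoothing (R : realType) n (bl bu : 'rV[R]_n) (beta : R)
    (c : 'rV[R]_n -> R) (x : 'rV[R]_n) : R :=
  let a := beta^-1 *: (bl - x) in
  let b := beta^-1 *: (bu - x) in
  \int[truncated_gaussian a b]_(u in box a b) c (x + beta *: u).

(* Main.v *)
(* Substituting y = x + beta u turns the mean of h(x + beta u), for u truncated
   Gaussian, into the ratio of the integrals over the fixed box [bl, bu] of
   h(y) K(x, y) and K(x, y), where K(x, y) is the product over i of
   g(y_i - x_i) and g(t) = phi(t / beta) / beta.  Only the kernel depends on x,
   so numerator and denominator may be differentiated under the integral, each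
   partial derivative raising the order of derivation of one factor g: both are
   smooth, and so is their quotient c^beta.  Since g'(t) = - (t / beta^2) g(t),
   the i-th partial derivative of c^beta is
   beta^-1 (E[u_i c(x + beta u)] - E[u_i] E[c(x + beta u)]), which is the mean of
   both estimators because E[u - mu] = 0 and - u_2 has the law of u_1.  The
   Lipschitz bound follows from E[u_i^2] <= 1 when x is in the box, an
   integration by parts. *)
Require Import Defs.
From HB Require Import structures.
From mathcomp Require Import all_boot all_order all_algebra.
From mathcomp Require Import all_classical all_reals all_analysis.
From mathcomp Require Import ring lra.

Import Order.TTheory GRing.Theory Num.Theory.
Import numFieldNormedType.Exports measurable_realfun.

Local Open Scope classical_set_scope.
Local Open Scope ring_scope.

(** The function [c] is merely integrable and is known on the box alone, so changes of variables are
    proved for nonnegative functions on the whole space, where Tonelli asks for no integrability,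
    and are transferred to real functions on the box only afterwards. The scale [s] may have either
    sign, with absolute value [beta]: since [phi] is even, [x + beta u1] and [x - beta u2] lead to
    the same weighted integral. Boundedness of the box makes differentiation under the integral
    possible: when [x'] is within distance 1 of [x] and [y] is in the box, the arguments of the
    kernel stay in one segment, where each of its derivatives is bounded, so a constant times the
    absolute value of [c] is an integrable majorant. Partial derivatives alone do not give
    continuity in several variables; every level of [class_C] gets it from a local Lipschitz bound.
    The strict inequalities between [bl] and [bu] keep the denominator positive. *)

(** * One-dimensional affine changes of variables *)

Lemma ge0_integral_normal_prob {R : realType} (m s : R)
    (f : R -> \bar R) :
  measurable_fun [set: measurableTypeR R] f -> (forall t, 0 <= f t)%E ->
  (\int[normal_prob m s]_t f t =
   \int[@lebesgue_measure R]_t (f t * (normal_pdf m s t)%:E))%E.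
Proof.
move=> mf f0; have dom := normal_prob_dominates m s.
rewrite -(Radon_Nikodym_SigmaFinite.change_of_variables dom f0 measurableT mf).
have mpdf : measurable_fun [set: measurableTypeR R] (EFin \o normal_pdf m s).
  by apply/measurable_EFinP; exact: measurable_normal_pdf.
apply: ae_eq_integral => //.
- apply: emeasurable_funM => //.
  exact: measurable_int (Radon_Nikodym_SigmaFinite.f_integrable dom).
- exact: emeasurable_funM.
(* The Radon-Nikodym derivative and the density have the same integral over every measurable set,
   hence agree almost everywhere. *)
- apply: ae_eqe_mul2l; apply: integral_ae_eq => //.
  + exact: Radon_Nikodym_SigmaFinite.f_integrable.
  + by move=> E _ mE; rewrite -Radon_Nikodym_SigmaFinite.f_integral.
Qed.

(** By uniqueness of Lebesgue measure it is enough to compare the rescaled pushforward with it on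
    intervals []a, b]]. A negative [s] swaps the open and the closed end of the preimage, hence the
    two cases. *)
Lemma lebesgue_measure_affine {R : realType} (x s : R) (A : set R) : s != 0 ->
  measurable A ->
  (`|s|%:E * (@lebesgue_measure R) ((fun t => x + s * t)%R @^-1` A) =
   lebesgue_measure A)%E.
Proof.
move=> s0 mA.
have mT : measurable_fun [set: measurableTypeR R]
    (fun t => x + s * t : measurableTypeR R).
  by apply: measurable_funD => //; exact: measurable_funM.
pose push :=
  measure_function_pushforward__canonical__measure_function_Measure
    (@lebesgue_measure R) mT.
pose mu := mscale (NngNum (normr_ge0 s)) push.
rewrite [RHS](_ : _ = mu A) //; apply: (@lebesgue_measure_unique _ mu) => //.
move=> _ [[a b]] _ <-.
change (lebesgue_measure `]a, b] = `|s|%:E *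
  (@lebesgue_measure R) ((fun t => x + s * t)%R @^-1` `]a, b]))%E.
have [s_lt0|s_gt0|s_eq0] := ltgtP s 0; last by rewrite s_eq0 eqxx in s0.
- rewrite (_ : _ @^-1` _ =
      `[((b - x) / s), ((a - x) / s)[%classic); last first.
    apply/seteqP; split=> t /=; rewrite !in_itv /= ler_ndivrMr ?ltr_ndivlMr//;
    by rewrite ltrBlDl lerBrDl ![_ * s]mulrC => /andP[-> ->].
  rewrite !lebesgue_measure_itv /= !lte_fin.
  rewrite ltr_nM2r ?invr_lt0// ltrD2r.
  case: ifPn => ab; last by rewrite mule0.
  rewrite -!EFinB -EFinM ltr0_norm//; congr EFin.
  by field.
- rewrite (_ : _ @^-1` _ =
      `]((a - x) / s), ((b - x) / s)]%classic); last first.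
    apply/seteqP; split=> t /=; rewrite !in_itv /= ler_pdivlMr ?ltr_pdivrMr//;
    by rewrite ltrBlDl lerBrDl ![_ * s]mulrC => /andP[-> ->].
  rewrite !lebesgue_measure_itv /= !lte_fin.
  rewrite ltr_pM2r ?invr_gt0// ltrD2r.
  case: ifPn => ab; last by rewrite mule0.
  rewrite -!EFinB -EFinM gtr0_norm//; congr EFin.
  by field.
Qed.

Lemma ge0_integral_affine {R : realType} (x s : R)
    (f : R -> \bar R) : s != 0 ->
  measurable_fun [set: measurableTypeR R] f -> (forall t, 0 <= f t)%E ->
  (\int[@lebesgue_measure R]_y f y =
   `|s|%:E * \int[@lebesgue_measure R]_t f (x + s * t)%R)%E.
Proof.
move=> s0 mf f0.
have mT : measurable_fun [set: measurableTypeR R]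
    (fun t => x + s * t : measurableTypeR R).
  by apply: measurable_funD => //; exact: measurable_funM.
pose push :=
  measure_function_pushforward__canonical__measure_function_Measure
    (@lebesgue_measure R) mT.
have -> : (\int[@lebesgue_measure R]_t f (x + s * t)%R = \int[push]_t f t)%E.
  by rewrite ge0_integral_pushforward.
rewrite -(ge0_integral_mscale _ _ (NngNum (normr_ge0 s)))//.
apply: eq_measure_integral => A mA _.
exact/esym/(lebesgue_measure_affine x s).
Qed.

Lemma ge0_integral_normal_affine {R : realType} (x s : R)
    (f : R -> \bar R) : s != 0 ->
  measurable_fun [set: measurableTypeR R] f -> (forall t, 0 <= f t)%E ->
  (\int[normal_prob 0 1]_t f (x + s * t)%R =
   \int[@lebesgue_measure R]_y (f y * (phi ((y - x) / s) / `|s|)%:E))%E.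
Proof.
move=> s0 mf f0.
have mT : measurable_fun [set: measurableTypeR R]
    (fun t => x + s * t : measurableTypeR R).
  by apply: measurable_funD => //; exact: measurable_funM.
have mphi : measurable_fun [set: R] (@phi R) := measurable_normal_pdf 0 1.
have phi0 t : 0 <= phi t :> R := normal_pdf_ge0 0 1 t.
have mk : measurable_fun [set: measurableTypeR R]
    (fun y => (phi ((y - x) / s) / `|s|)%:E).
  apply/measurable_EFinP; apply: measurable_funM => //.
  apply: (measurableT_comp mphi); apply: measurable_funM => //.
  exact: measurable_funB.
rewrite ge0_integral_normal_prob//; last exact: (measurableT_comp mf).
rewrite [RHS](ge0_integral_affine x s) //; last 2 first.
  exact: emeasurable_funM.
  by move=> t; rewrite mule_ge0// lee_fin divr_ge0.
rewrite -ge0_integralZl//; last 2 first.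
- by apply: emeasurable_funM;
    [exact: (measurableT_comp mf)|exact: (measurableT_comp mk)].
- by move=> t _; rewrite mule_ge0// lee_fin divr_ge0.
apply: eq_integral => t _; rewrite muleCA -EFinM; congr (_ * (_)%:E)%E.
by rewrite mulrCA divff ?normr_eq0// mulr1 [x + _]addrC addrK [s * t]mulrC mulfK.
Qed.

(** * Integration on product measures *)

Section power_measure_integral.
Context {R : realType}.
Local Open Scope ereal_scope.
Implicit Types mu nu : {sigma_finite_measure set (measurableTypeR R) -> \bar R}.

Lemma ge0_integral_power_measureS mu n (F : 'rV[R]_n.+1 -> \bar R) :
  measurable_fun setT F -> (forall v, 0 <= F v) ->
  \int[power_measure mu n.+1]_u F u =
  \int[mu]_t \int[power_measure mu n]_v F (cons_rV (t, v)).
Proof.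
move=> mF F0.
have mFc : measurable_fun [set: measurableTypeR R * 'rV[R]_n]
    (F \o @cons_rV R n) by exact: measurableT_comp mF (@measurable_cons_rV R n).
rewrite -(fubini_tonelli1 (m1 := mu) (m2 := power_measure mu n) _ mFc); last
  by move=> p; exact: F0.
apply: (ge0_integral_pushforward (@measurable_cons_rV R n)
  (mu \x power_measure mu n) measurableT mF) => v _; exact: F0.
Qed.

Lemma measurable_fun_sliceF nu n (F : 'rV[R]_n.+1 -> \bar R) :
  measurable_fun setT F -> (forall v, 0 <= F v) ->
  measurable_fun [set: measurableTypeR R]
    (fun t => \int[power_measure nu n]_v F (cons_rV (t, v))).
Proof.
move=> mF F0; apply: (@measurable_fun_fubini_tonelli_F _ _ _ _ _
  (power_measure nu n) (F \o @cons_rV R n)) => [|p]; last exact: F0.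
exact: measurableT_comp mF (@measurable_cons_rV R n).
Qed.

Lemma cons_rV0 n (p : measurableTypeR R * 'rV[R]_n) : cons_rV p ord0 ord0 = p.1.
Proof. by rewrite mxE unlift_none. Qed.

Lemma cons_rV_lift n (p : measurableTypeR R * 'rV[R]_n) j :
  cons_rV p ord0 (lift ord0 j) = p.2 ord0 j.
Proof. by rewrite mxE liftK. Qed.

Lemma measurable_cons_rV_slice n (t : R) :
  measurable_fun [set: 'rV[R]_n]
    (fun v => @cons_rV R n ((t : measurableTypeR R), v)).
Proof. exact: measurableT_comp (@measurable_cons_rV R n) (measurable_pair1 t). Qed.

Lemma measurable_prod_coord n (h : 'I_n -> R -> R) :
  (forall i, measurable_fun [set: measurableTypeR R]
    (h i : _ -> measurableTypeR R)) ->
  measurable_fun [set: 'rV[R]_n] (fun y => (\prod_i h i (y ord0 i))%R).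
Proof.
move=> mh; apply: measurable_prod => i _.
exact: measurableT_comp (mh i) (@measurable_coord R n i).
Qed.

(* One-dimensional changes of variables tensorize. *)
Lemma ge0_integral_power_measure_change mu nu n
    (T : 'I_n -> R -> R) (h : 'I_n -> R -> R) :
  (forall i, measurable_fun [set: measurableTypeR R]
    (T i : _ -> measurableTypeR R)) ->
  (forall i, measurable_fun [set: measurableTypeR R]
    (h i : _ -> measurableTypeR R)) ->
  (forall i t, (0 <= h i t)%R) ->
  (forall i (f : R -> \bar R), measurable_fun [set: measurableTypeR R] f ->
    (forall t, 0 <= f t) ->
    \int[mu]_t f (T i t) = \int[nu]_y (f y * (h i y)%:E)) ->
  forall F : 'rV[R]_n -> \bar R, measurable_fun setT F -> (forall v, 0 <= F v) ->
  \int[power_measure mu n]_u F (\row_i T i (u ord0 i))%R =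
  \int[power_measure nu n]_y (F y * (\prod_i h i (y ord0 i))%:E).
Proof.
elim: n T h => [|n IHn] T h mT mh h0 changeT F mF F0.
  apply: eq_integral => y _; rewrite big_ord0 mule1; congr F.
  by apply/rowP => -[].
have mrow : measurable_fun [set: 'rV[R]_n.+1]
    (fun u => (\row_i T i (u ord0 i))%R : 'rV[R]_n.+1).
  apply/measurable_fun_coordP => i; under eq_fun do rewrite mxE.
  exact: measurableT_comp (mT i) (@measurable_coord R n.+1 i).
have prod_ge0 k (g : 'I_k -> R -> R) (y : 'rV[R]_k) :
    (forall i t, (0 <= g i t)%R) ->
    0 <= (\prod_i g i (y ord0 i))%:E.
  by move=> g0; rewrite lee_fin prodr_ge0.
pose h' := fun j => h (lift ord0 j).
(* [G] is what the inner integral becomes once the last coordinates are changed by induction.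
   Writing it with [F'], defined on the whole space, makes it a slice integral and so measurable, as
   the one-dimensional change applied to [G] requires. *)
pose G t := \int[power_measure nu n]_v
  (F (cons_rV (t, v)) * (\prod_j h' j (v ord0 j))%:E).
have mprod' : measurable_fun [set: 'rV[R]_n.+1]
    (fun y => (\prod_j h' j (y ord0 (lift ord0 j)))%R).
  apply: measurable_prod => j _.
  exact: measurableT_comp (mh (lift ord0 j)) (@measurable_coord R n.+1 _).
pose F' (y : 'rV[R]_n.+1) := F y * (\prod_j h' j (y ord0 (lift ord0 j)))%:E.
have mF' : measurable_fun setT F'.
  by apply: emeasurable_funM => //; apply/measurable_EFinP.
have F'0 y : 0 <= F' y.
  by rewrite mule_ge0// lee_fin prodr_ge0// => j _; exact: h0.
have GE t : G t = \int[power_measure nu n]_v F' (cons_rV (t, v)).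
  by apply: eq_integral => v _; rewrite /F';
    under [in RHS]eq_bigr do rewrite cons_rV_lift.
rewrite ge0_integral_power_measureS//; last exact: measurableT_comp mF mrow.
rewrite (_ : (fun t => _) = G \o T ord0); last first.
  apply/funext => t /=; rewrite /G.
  rewrite -(IHn (fun j => T (lift ord0 j)) h')//.
  - apply: eq_integral => v _; congr F; apply/rowP => i; rewrite !mxE.
    by case: (unliftP ord0 i) => [j|] -> /=; rewrite ?mxE.
  - by move=> i; exact: mh.
  - by move=> i; exact: h0.
  - by move=> i; exact: changeT.
  - exact: measurableT_comp mF (measurable_cons_rV_slice _ _).
rewrite [LHS]changeT; last 2 first.
- rewrite (_ : G = fun t => \int[power_measure nu n]_v F' (cons_rV (t, v))).
    exact: measurable_fun_sliceF.
  by apply/funext => t; rewrite GE.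
- by move=> t; rewrite GE integral_ge0.
rewrite [RHS]ge0_integral_power_measureS//; last 2 first.
- apply: emeasurable_funM => //; apply/measurable_EFinP.
  exact: measurable_prod_coord.
- by move=> y; rewrite mule_ge0// prod_ge0.
apply: eq_integral => t _; rewrite GE -ge0_integralZr//; last 2 first.
- exact: measurableT_comp mF' (measurable_cons_rV_slice _ _).
- by rewrite lee_fin.
apply: eq_integral => v _; rewrite /F' -muleA -EFinM big_ord_recl cons_rV0 /=.
by congr (_ * (_)%:E); rewrite mulrC.
Qed.

Lemma ge0_integral_power_measure_prod mu n (p : 'I_n -> R -> R) :
  (forall i, measurable_fun [set: measurableTypeR R]
    (p i : _ -> measurableTypeR R)) ->
  (forall i t, (0 <= p i t)%R) ->
  \int[power_measure mu n]_u (\prod_i p i (u ord0 i))%:E =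
  \prod_i \int[mu]_t (p i t)%:E.
Proof.
elim: n p => [|n IHn] p mp p0.
  rewrite big_ord0 integral_dirac// ?diracT ?big_ord0 ?mul1e//.
  by under eq_fun do rewrite big_ord0; exact: measurable_cst.
rewrite ge0_integral_power_measureS; last 2 first.
- by apply/measurable_EFinP; exact: measurable_prod_coord.
- by move=> v; rewrite lee_fin prodr_ge0.
rewrite big_ord_recl -IHn//.
rewrite -ge0_integralZr//; last 3 first.
- by apply/measurable_EFinP; exact: mp.
- by move=> t _; rewrite lee_fin.
- by apply: integral_ge0 => v _; rewrite lee_fin prodr_ge0.
apply: eq_integral => t _.
under eq_integral => v _.
  rewrite big_ord_recl cons_rV0 EFinM /=.
  under eq_bigr do rewrite cons_rV_lift.
  over.
rewrite ge0_integralZl//.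
- apply/measurable_EFinP.
  by apply: (measurable_prod_coord _ (fun j => p (lift ord0 j))) => j; exact: mp.
- by move=> v _; rewrite lee_fin prodr_ge0.
- by rewrite lee_fin.
Qed.

End power_measure_integral.

(** Passage from nonnegative to real integrands, by absolute value and by positive and negative
    parts, all of which commute with the weight [k] because it is nonnegative. As [h] is measurable
    on [D] only, it is first extended by zero. It serves both for the truncated Gaussian on its box
    and for an arbitrary probability space. *)
Lemma ge0_change_integrable {R : realType} d d'
    (X : measurableType d) (Y : measurableType d')
    (m : {measure set X -> \bar R}) (nu : {measure set Y -> \bar R})
    (E : set X) (D : set Y) (T : X -> Y) (k : Y -> R) :
  measurable E -> measurable D -> measurable_fun E T ->
  (forall w, E w -> D (T w)) -> (forall y, 0 <= k y) ->
  (forall F : Y -> \bar R, measurable_fun setT F -> (forall y, 0 <= F y)%E ->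
    (\int[m]_(w in E) F (T w) = \int[nu]_(y in D) (F y * (k y)%:E))%E) ->
  forall h : Y -> R, measurable_fun D h ->
  nu.-integrable D (fun y => (h y * k y)%:E) ->
  m.-integrable E (fun w => (h (T w))%:E) /\
  (\int[m]_(w in E) (h (T w))%:E = \int[nu]_(y in D) (h y * k y)%:E)%E.
Proof.
move=> mE mD mT ET k0 changeT h mh ihk.
pose g : Y -> \bar R := EFin \o (h \_ D).
have mg : measurable_fun setT g.
  by apply/measurable_EFinP/(measurable_restrictT _ mD).1.
have gE y : D y -> g y = (h y)%:E by move=> Dy; rewrite /g /= patchE mem_set.
have gTE w : E w -> (h (T w))%:E = g (T w) by move=> /ET Dw; rewrite gE.
split.
  apply/integrableP; split.
    apply: (eq_measurable_fun (g \o T)) => [w /set_mem Ew|].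
      by rewrite gTE.
    exact: (measurable_comp measurableT _ mg mT).
  have -> : (\int[m]_(w in E) `|(h (T w))%:E| =
      \int[m]_(w in E) ((abse \o g) (T w)))%E.
    by apply: eq_integral => w /set_mem Ew; rewrite gTE.
  rewrite changeT; last 2 first.
  - exact: measurableT_comp.
  - by move=> y; exact: abse_ge0.
  rewrite (eq_integral (fun y => `|(h y * k y)%:E|%E)); last first.
    move=> y /set_mem Dy.
    by rewrite [(abse \o g) y]/comp gE// -EFinM /= normrM (ger0_norm (k0 y)).
  by have /integrableP[] := ihk.
rewrite integralE [RHS]integralE; congr (_ - _)%E.
- rewrite (eq_integral (fun w => (g^\+)%E (T w))); last first.
    by move=> w /set_mem Ew; rewrite !funeposE gTE.
  rewrite changeT; last 2 first.
  - exact: measurable_funepos.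
  - by move=> y; exact: funepos_ge0.
  apply: eq_integral => y /set_mem Dy.
  by rewrite !funeposE gE// -!EFin_max -EFinM maxr_pMl// mul0r.
- rewrite (eq_integral (fun w => (g^\-)%E (T w))); last first.
    by move=> w /set_mem Ew; rewrite !funenegE gTE.
  rewrite changeT; last 2 first.
  - exact: measurable_funeneg.
  - by move=> y; exact: funeneg_ge0.
  apply: eq_integral => y /set_mem Dy.
  by rewrite !funenegE gE// -!EFinN -!EFin_max -EFinM maxr_pMl// mul0r mulNr.
Qed.

(** * Change of variables for the truncated Gaussian *)

(** For [beta > 0], the density of [beta] times a standard Gaussian variable. *)
Definition gauss_kernel {R : realType} (beta t : R) : R := phi (t / beta) / beta.

Definition box_kernel {R : realType} {n : nat} (beta : R) (x y : 'rV[R]_n) : R :=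
  \prod_i gauss_kernel beta (y ord0 i - x ord0 i).

Lemma phi_ge0 {R : realType} (t : R) : 0 <= phi t.
Proof. exact: normal_pdf_ge0. Qed.

Lemma phiE {R : realType} (t : R) :
  phi t = normal_peak 1 * expR (- (t ^+ 2 / 2)).
Proof.
rewrite /phi normal_pdfE ?oner_eq0// /normal_fun subr0 expr1n.
by rewrite mulr2n mulNr.
Qed.

Lemma phi_gt0 {R : realType} (t : R) : 0 < phi t.
Proof. by rewrite phiE mulr_gt0 ?expR_gt0 ?normal_peak_gt0 ?oner_neq0. Qed.

Lemma phiN {R : realType} (t : R) : phi (- t) = phi t.
Proof. by rewrite !phiE sqrrN. Qed.

Lemma measurable_phi {R : realType} : measurable_fun [set: R] (@phi R).
Proof. exact: measurable_normal_pdf. Qed.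

Section truncated_gaussian_change.
Context {R : realType} {n : nat}.
Variables (beta : R) (x : 'rV[R]_n).
Hypothesis beta0 : 0 < beta.
Local Notation K := (box_kernel beta x).

Lemma gauss_kernel_gt0 t : 0 < gauss_kernel beta t.
Proof. by rewrite /gauss_kernel divr_gt0// phi_gt0. Qed.

Lemma measurable_gauss_kernel c : measurable_fun [set: measurableTypeR R]
  (fun t => gauss_kernel beta (t - c) : measurableTypeR R).
Proof.
apply: measurable_funM => //; apply: (measurableT_comp measurable_phi).
by apply: measurable_funM => //; exact: measurable_funB.
Qed.

Lemma box_kernel_gt0 y : 0 < K y.
Proof. by rewrite prodr_gt0// => i _; exact: gauss_kernel_gt0. Qed.

Lemma measurable_box_kernel : measurable_fun setT K.
Proof.
apply: (measurable_prod_coord _ (fun i t => gauss_kernel beta (t - x ord0 i))) => i.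
exact: measurable_gauss_kernel.
Qed.

Lemma ge0_integral_std_gaussian_affine (s : R) (F : 'rV[R]_n -> \bar R) :
  `|s| = beta -> measurable_fun setT F -> (forall v, 0 <= F v)%E ->
  (\int[std_gaussian n]_u F (x + s *: u)%R =
   \int[lebesgue_rV n]_y (F y * (K y)%:E))%E.
Proof.
move=> sb mF F0.
have s0 : s != 0 by rewrite -normr_eq0 sb gt_eqF.
rewrite -(ge0_integral_power_measure_change (normal_prob 0 1) _ _
  (fun i t => x ord0 i + s * t)
  (fun i t => gauss_kernel beta (t - x ord0 i)))//.
- by apply: eq_integral => u _; congr F; apply/rowP => i; rewrite !mxE.
- by move=> i; apply: measurable_funD => //; exact: measurable_funM.
- by move=> i; exact: measurable_gauss_kernel.
- by move=> i t; exact/ltW/gauss_kernel_gt0.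
- move=> i f mf f0; rewrite ge0_integral_normal_affine//.
  apply: eq_integral => y _; rewrite /gauss_kernel -sb.
  rewrite [in RHS](_ : phi _ = phi ((y - x ord0 i) / s))//.
  (* Evenness of [phi] makes the kernel insensitive to the sign of [s]. *)
  by case: ler0P => _ //; rewrite invrN mulrN phiN.
Qed.

End truncated_gaussian_change.

Section truncated_gaussian_box.
Context {R : realType} {n : nat}.
Variables (beta s : R) (bl bu a b x : 'rV[R]_n).
Hypotheses (beta0 : 0 < beta) (sb : `|s| = beta).
Hypothesis boxE : forall u, box a b u <-> box bl bu (x + s *: u).
Local Notation K := (box_kernel beta x).
Local Notation D := (box bl bu).

Lemma std_gaussian_boxE :
  std_gaussian n (box a b) = (\int[lebesgue_rV n]_(y in D) (K y)%:E)%E.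
Proof.
rewrite -(setIT (box a b)) -integral_indic//; last exact: measurable_box.
under eq_integral => u _.
  rewrite (_ : \1_(box a b) u = \1_D (x + s *: u)); last first.
    by rewrite !indicE; congr (nat_of_bool _)%:R;
      apply/idP/idP => /set_mem/boxE/mem_set.
  over.
rewrite /= (ge0_integral_std_gaussian_affine beta x beta0 s
  (EFin \o \1_D))//; last 2 first.
- by apply/measurable_EFinP; apply: measurable_indic; exact: measurable_box.
- by move=> v; rewrite lee_fin.
rewrite [RHS]integral_mkcond; apply: eq_integral => y _.
by rewrite patchE /= indicE; case: ifPn => _; rewrite ?mul1e// mul0e.
Qed.

Local Notation Z := (fine (std_gaussian n (box a b))).

Lemma ge0_integral_truncated_gaussian (F : 'rV[R]_n -> \bar R) :
  measurable_fun setT F -> (forall v, 0 <= F v)%E ->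
  (\int[truncated_gaussian a b]_(u in box a b) F (x + s *: u)%R =
   \int[lebesgue_rV n]_(y in D) (F y * (K y / Z)%:E))%E.
Proof.
move=> mF F0; have mD : measurable D by exact: measurable_box.
have mab : measurable (box a b) by exact: measurable_box.
have mT : measurable_fun [set: 'rV[R]_n] (fun u : 'rV[R]_n => x + s *: u).
  apply/measurable_fun_coordP => i; under eq_fun do rewrite !mxE.
  by apply: measurable_funD => //; apply: measurable_funM => //;
    exact: measurable_coord.
have mFT : measurable_fun setT (fun u : 'rV[R]_n => F (x + s *: u)).
  exact: measurableT_comp mF mT.
(* On subsets of its own box the truncated law is the standard Gaussian measure multiplied by a
   constant. *)
rewrite (eq_measure_integral (mscale
    (NngNum (truncated_gaussian_weight_ge0 a b)) (std_gaussian n))); last first.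
  move=> A mA Aab; exact: (congr1 (fun B => (Z^-1)%:E * std_gaussian n B)%E
    (setIidl Aab)).
rewrite ge0_integral_mscale//; last exact: measurable_funTS.
rewrite integral_mkcond.
have -> : (fun u => F (x + s *: u)) \_ (box a b) = fun u => (F \_ D) (x + s *: u).
  apply/funext => u; rewrite !patchE; congr (if _ then _ else _).
  by apply/idP/idP => /set_mem/boxE/mem_set.
rewrite (ge0_integral_std_gaussian_affine beta x beta0)//; last 2 first.
- by apply/(measurable_restrictT _ mD); exact: measurable_funTS.
- exact: erestrict_ge0.
rewrite [in RHS]integral_mkcond -ge0_integralZl//; last 2 first.
- apply: emeasurable_funM.
    by apply/(measurable_restrictT _ mD); exact: measurable_funTS.
  by apply/measurable_EFinP; exact: measurable_box_kernel.
- move=> y _; rewrite mule_ge0 ?lee_fin//; first exact: erestrict_ge0.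
  by rewrite ltW// box_kernel_gt0.
apply: eq_integral => y _; rewrite !patchE.
case: ifPn => _; last by rewrite !mul0e mule0.
by rewrite muleCA EFinM [in RHS](muleC (K y)%:E).
Qed.

End truncated_gaussian_box.

(** * Smoothness of box convolutions *)

Definition smooth1 {R : realType} (g : R -> R) : Prop :=
  forall (k : nat) (t : R), derivable (g^`(k)%classic : R -> R) t 1.

Lemma smooth1_continuous {R : realType} (g : R -> R) (k : nat) :
  smooth1 g -> continuous (g^`(k)%classic : R -> R).
Proof.
by move=> sg t; apply: differentiable_continuous; exact/derivable1_diffP.
Qed.

Lemma smooth1_is_derive {R : realType} (g : R -> R) (k : nat) (t : R) :
  smooth1 g -> is_derive t 1 (g^`(k)%classic : R -> R) (g^`(k.+1)%classic t).
Proof. by move=> sg; apply: DeriveDef; rewrite // derive1nS derive1E. Qed.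

Lemma continuous_segment_bounded {R : realType} (f : R -> R) (r : R) :
  continuous f -> exists2 M, 0 <= M & forall t, `|t| <= r -> `|f t| <= M.
Proof.
move=> cf; have [r0|r0] := ltP r 0.
  exists 0 => // t tr; have := lt_le_trans (le_lt_trans tr r0) (normr_ge0 t).
  by rewrite ltxx.
have cnf : {within `[- r, r], continuous (fun t => `|f t|)}.
  apply: continuous_subspaceT => t.
  exact: continuous_comp (cf t) (@norm_continuous _ _ _).
have rr : - r <= r by rewrite (le_trans _ r0)// oppr_le0.
have [t0 _ fM] := EVT_max rr cnf; exists `|f t0| => // t tr.
by apply: fM; rewrite in_itv /= -ler_norml.
Qed.

Lemma continuous_family_bounded {R : realType} (I : finType) (f : I -> R -> R)
    (r : R) : (forall i, continuous (f i)) ->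
  exists2 M, 1 <= M & forall i t, `|t| <= r -> `|f i t| <= M.
Proof.
move=> cf.
have /choice[M HM] : forall i, exists M,
    0 <= M /\ forall t, `|t| <= r -> `|f i t| <= M.
  by move=> i; have [M ? ?] := continuous_segment_bounded (f i) r (cf i); exists M.
have M0 i : 0 <= M i by case: (HM i).
(* The sum dominates every individual bound; the added 1 gives [1 <= M], on which the estimate for
   differences of products relies. *)
exists (1 + \sum_i M i); first by rewrite lerDl sumr_ge0.
move=> i t tr; have [_ /(_ t tr) fM] := HM i; apply: (le_trans fM).
by rewrite (bigD1 i)//= addrCA lerDl addr_ge0// sumr_ge0.
Qed.

(** Telescoping: the factors are exchanged one at a time, each exchange costing at most [e] times a
    product of factors bounded by [M]. Since [1 <= M], the same power [M ^+ size r] can be used for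
    all of them. *)
Lemma ler_norm_prodB {R : realType} (I : Type) (r : seq I) (a b : I -> R)
    (M e : R) : 1 <= M -> 0 <= e ->
  (forall i, `|a i| <= M) -> (forall i, `|b i| <= M) ->
  (forall i, `|a i - b i| <= e) ->
  `|\prod_(i <- r) a i - \prod_(i <- r) b i| <= e * ((size r)%:R * M ^+ size r).
Proof.
move=> M1 e0 aM bM ab; have M0 : 0 <= M by exact: le_trans M1.
elim: r => [|i r IHr]; first by rewrite !big_nil subrr normr0 mul0r mulr0.
have bprod : `|\prod_(j <- r) b j| <= M ^+ size r.
  elim: r {IHr} => [|j r IHr]; first by rewrite big_nil normr1.
  by rewrite big_cons normrM exprS ler_pM.
rewrite !big_cons [X in `|X|](_ : _ = a i * (\prod_(j <- r) a j -
  \prod_(j <- r) b j) + (a i - b i) * \prod_(j <- r) b j); last by ring.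
rewrite (le_trans (ler_normD _ _))// !normrM.
rewrite (@le_trans _ _ (M * (e * ((size r)%:R * M ^+ size r)) + e * M ^+ size r))//.
  by rewrite lerD// ler_pM.
rewrite /= -natr1 exprS.
rewrite -subr_ge0 [X in _ <= X](_ : _ = e * (M - 1) * M ^+ size r); last by ring.
by rewrite !mulr_ge0// ?exprn_ge0// subr_ge0.
Qed.

Lemma ler_norm_row {R : realType} n (v : 'rV[R]_n) i : `|v ord0 i| <= `|v|.
Proof.
rewrite [leRHS]/Num.Def.normr /= mx_normrE; apply/bigmax_geP; right => /=.
by exists (ord0, i).
Qed.

(** Up to the sign [(-1)] to the sum of the [k i], this is the mixed partial derivative of order
    [k], in [x], of the product kernel. *)
Definition multi_kernel {R : realType} {n : nat} (g : R -> R) (k : 'I_n -> nat)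
    (x y : 'rV[R]_n) : R :=
  \prod_i (g^`(k i)%classic : R -> R) (y ord0 i - x ord0 i).

Definition box_conv {R : realType} {n : nat} (bl bu : 'rV[R]_n) (g : R -> R)
    (c : 'rV[R]_n -> R) (k : 'I_n -> nat) (x : 'rV[R]_n) : R :=
  \int[lebesgue_rV n]_(y in box bl bu) (c y * multi_kernel g k x y).

Section box_convolution.
Context {R : realType} {n : nat}.
Variables (bl bu : 'rV[R]_n) (g : R -> R).
Hypothesis sg : smooth1 g.
Local Notation D := (box bl bu).
Local Notation K := (@multi_kernel R n g).

(** Provides one radius valid for all [x'] in the unit ball around [x] and all [y] in the box, so
    that [g] and its derivatives are only evaluated on a fixed segment. *)
Lemma box_sub_bounded (x x' y : 'rV[R]_n) i : `|x' - x| <= 1 -> D y ->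
  `|y ord0 i - x' ord0 i| <= `|bl - x| + `|bu - x| + 1.
Proof.
move=> x'x Dy; have /andP[bly ybu] := Dy i.
have := le_trans (ler_norm_row n (x' - x) i) x'x; rewrite !mxE.
have := ler_norm_row n (bl - x) i; have := ler_norm_row n (bu - x) i.
rewrite !mxE !ler_norml.
have := normr_ge0 (bl - x); have := normr_ge0 (bu - x).
move=> ? ? /andP[? ?] /andP[? ?] /andP[? ?]; apply/andP; split; lra.
Qed.

Lemma multi_kernel_bounded k (x : 'rV[R]_n) :
  exists2 M, 0 <= M & forall x' y, `|x' - x| <= 1 -> D y -> `|K k x' y| <= M.
Proof.
have [M M1 gM] := continuous_family_bounded _ (fun i : 'I_n => g^`(k i)%classic)
  (`|bl - x| + `|bu - x| + 1) (fun i => smooth1_continuous g (k i) sg).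
have M0 : 0 <= M by exact: le_trans M1.
exists (\prod_(i < n) M) => [|x' y x'x Dy]; first exact: prodr_ge0.
rewrite normr_prod; apply: ler_prod => i _; rewrite normr_ge0 /=.
by apply: gM; exact: box_sub_bounded.
Qed.

(** Each factor is Lipschitz on the segment by the mean value theorem, with a bound [M'] on the next
    derivative as constant; telescoping extends this to the product. The constant [C] is uniform in
    [y], so the estimate survives integration against [c]. *)
Lemma multi_kernel_lipschitz k (x : 'rV[R]_n) :
  exists2 C, 0 <= C & forall x' y, `|x' - x| <= 1 -> D y ->
    `|K k x' y - K k x y| <= C * `|x' - x|.
Proof.
set r := `|bl - x| + `|bu - x| + 1.
have [M M1 gM] := continuous_family_bounded _ (fun i : 'I_n => g^`(k i)%classic)
  r (fun i => smooth1_continuous g (k i) sg).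
have [M' M'1 gM'] := continuous_family_bounded _
  (fun i : 'I_n => g^`((k i).+1)%classic) r
  (fun i => smooth1_continuous g (k i).+1 sg).
have M0 : 0 <= M by exact: le_trans M1.
have M'0 : 0 <= M' by exact: le_trans M'1.
have lip i t t' : t < t' -> `|t| <= r -> `|t'| <= r ->
    `|(g^`(k i)%classic : R -> R) t' - (g^`(k i)%classic : R -> R) t| <=
       M' * (t' - t).
  move=> tt' tr t'r.
  have [z] := MVT tt' (fun s _ => smooth1_is_derive g (k i) s sg)
    (continuous_subspaceT (smooth1_continuous g (k i) sg)).
  rewrite in_itv /= => /andP[tz zt'] ->.
  rewrite normrM (gtr0_norm (x := t' - t)) ?subr_gt0//.
  rewrite ler_wpM2r ?subr_ge0 ?(ltW tt')//; apply: gM'; move: tr t'r.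
  rewrite !ler_norml => /andP[? ?] /andP[? ?]; apply/andP; split; lra.
exists (M' * ((size (index_enum 'I_n))%:R * M ^+ size (index_enum 'I_n))).
  by rewrite !mulr_ge0// exprn_ge0.
move=> x' y x'x Dy; rewrite mulrAC.
have xx : `|x - x| <= 1 by rewrite subrr normr0 ler01.
apply: ler_norm_prodB => //.
- by rewrite mulr_ge0.
- by move=> i; apply: gM; exact: box_sub_bounded.
- by move=> i; apply: gM; exact: box_sub_bounded.
move=> i; have := ler_norm_row n (x' - x) i; rewrite !mxE => x'xi.
have := box_sub_bounded x x' y i x'x Dy; have := box_sub_bounded x x y i xx Dy.
rewrite -/r => yx yx'.
apply: (@le_trans _ _ (M' * `|x' ord0 i - x ord0 i|)); last by rewrite ler_wpM2l.
have [yy|yy|->] := ltgtP (y ord0 i - x' ord0 i) (y ord0 i - x ord0 i).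
- rewrite distrC (le_trans (lip i _ _ yy yx' yx))// ler_wpM2l//.
  by rewrite (le_trans _ (ler_norm _))//; lra.
- rewrite (le_trans (lip i _ _ yy yx yx'))// ler_wpM2l// distrC.
  by rewrite (le_trans _ (ler_norm _))//; lra.
- by rewrite subrr normr0 mulr_ge0.
Qed.

Lemma measurable_multi_kernel k x : measurable_fun [set: 'rV[R]_n] (K k x).
Proof.
apply: (measurable_prod_coord _
  (fun i t => (g^`(k i)%classic : R -> R) (t - x ord0 i))) => i.
apply: (measurableT_comp (continuous_measurable_fun
  (smooth1_continuous g (k i) sg))).
exact: measurable_funB.
Qed.

Variable c : 'rV[R]_n -> R.
Hypothesis ic : (lebesgue_rV n).-integrable D (EFin \o c).
Local Notation N := (box_conv bl bu g c).

Lemma integrable_box_conv k x :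
  (lebesgue_rV n).-integrable D (fun y => (c y * K k x y)%:E).
Proof.
have [M M0 KM] := multi_kernel_bounded k x.
have := @integrableMl _ _ _ _ _ (measurable_box bl bu) (EFin \o c) (K k x) ic.
apply.
  by apply: measurable_funTS; exact: measurable_multi_kernel.
exists M; split; first exact: num_real.
move=> M' MM' y Dy; apply: le_trans (ltW MM'); apply: KM Dy.
by rewrite subrr normr0.
Qed.

Lemma integrable_norm_scaled C :
  (lebesgue_rV n).-integrable D (fun y => (C * `|c y|)%:E).
Proof.
rewrite (_ : (fun _ => _) = (fun y => C%:E * (abse \o (EFin \o c)) y)%E)//.
by apply: integrableZl; [exact: measurable_box|exact: integrable_abse].
Qed.

Lemma continuous_box_conv k : continuous (N k).
Proof.
move=> x; apply/(@cvgrPdist_le _ _ _ _ (nbhs_filter x)) => e e0.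
have [C C0 lipC] := multi_kernel_lipschitz k x.
have mD := measurable_box bl bu.
pose I := \int[lebesgue_rV n]_(y in D) (C * `|c y|).
have I0 : 0 <= I by apply: Rintegral_ge0 => y _; rewrite mulr_ge0.
have lipN x' : `|x' - x| <= 1 -> `|N k x - N k x'| <= I * `|x' - x|.
  move=> x'x; rewrite distrC /box_conv.
  rewrite -RintegralB//; [|exact: integrable_box_conv..].
  rewrite (le_trans (le_normr_Rintegral _ _))//.
    rewrite /comp; under eq_fun do rewrite EFinB.
    by apply: integrableB => //; exact: integrable_box_conv.
  rewrite -RintegralZr//; last exact: integrable_norm_scaled.
  apply: le_Rintegral => //.
  - rewrite /comp; under eq_fun do rewrite -abse_EFin EFinB.
    by apply: integrable_abse; apply: integrableB => //; exact: integrable_box_conv.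
  - rewrite /comp; under eq_fun do rewrite mulrAC.
    exact: integrable_norm_scaled.
  - move=> y Dy; rewrite -mulrBr normrM mulrAC mulrC.
    by rewrite ler_wpM2r// lipC.
(* The Lipschitz constant [I] may vanish; [I + 1] can safely divide [e]. *)
have I1 : 0 < I + 1 by rewrite ltr_wpDl.
near=> x'; have x'1 : `|x' - x| <= 1.
  by rewrite distrC; near: x'; exact: cvgr_dist_le.
rewrite (le_trans (lipN x' x'1))//.
have {}x'1 : `|x' - x| <= e / (I + 1).
  by rewrite distrC; near: x'; apply: cvgr_dist_le => //; rewrite divr_gt0.
rewrite (@le_trans _ _ ((I + 1) * `|x' - x|)) ?ler_wpM2r ?lerDl//.
by rewrite mulrC -ler_pdivlMr.
Unshelve. all: by end_near. Qed.

End box_convolution.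

Definition incr_index {n : nat} (i : 'I_n) (k : 'I_n -> nat) : 'I_n -> nat :=
  fun j => (k j + (j == i))%N.

Section box_convolution_derive.
Context {R : realType} {n : nat}.
Variables (bl bu : 'rV[R]_n) (g : R -> R).
Hypothesis sg : smooth1 g.
Local Notation D := (box bl bu).
Local Notation K := (@multi_kernel R n g).
Local Notation e_ i := (delta_mx ord0 i : 'rV[R]_n).

(** Moving along one axis changes a single factor, the others forming the constant [A]. The minus
    sign comes from [x] entering through [y - x]. Every [t] is covered, and not just 0, because
    differentiation under the integral uses the derivative on a whole interval. *)
Lemma is_derive_multi_kernel (k : 'I_n -> nat) (x y : 'rV[R]_n) i (t : R) :
  is_derive t 1 (fun s : R => K k (s *: e_ i + x) y)
    (- K (incr_index i k) (t *: e_ i + x) y).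
Proof.
pose A := \prod_(j | j != i) (g^`(k j)%classic : R -> R) (y ord0 j - x ord0 j).
pose h (s : R) := y ord0 i - (s + x ord0 i).
have KE (k' : 'I_n -> nat) (s : R) : (forall j, j != i -> k' j = k j) ->
    K k' (s *: e_ i + x) y = A * (g^`(k' i)%classic : R -> R) (h s).
  move=> k'k; rewrite /multi_kernel (bigD1 i)//= mulrC; congr (_ * _).
    apply: eq_bigr => j ji; rewrite k'k// !mxE eqxx (negbTE ji) /=.
    by rewrite mulr0 add0r.
  by rewrite !mxE !eqxx mulr1.
rewrite KE; last by move=> j ji; rewrite /incr_index (negbTE ji) addn0.
rewrite (_ : (fun s => _) = A *: ((g^`(k i)%classic : R -> R) \o h)); last first.
  by apply/funext => s /=; rewrite KE.
rewrite (_ : - _ = A *: ((g^`((k i).+1)%classic : R -> R) (h t) * - 1)); last first.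
  by rewrite /incr_index eqxx addn1 mulrN1 scalerN.
apply: is_deriveZ; apply: is_derive1_comp.
  exact: smooth1_is_derive.
rewrite (_ : h = cst (y ord0 i) - (id + cst (x ord0 i)))//.
rewrite (_ : - 1 = 0 - (1 + 0) :> R); last by rewrite addr0 sub0r.
by apply: is_deriveB; apply: is_deriveD.
Qed.

Variable c : 'rV[R]_n -> R.
Hypothesis ic : (lebesgue_rV n).-integrable D (EFin \o c).
Local Notation N := (box_conv bl bu g c).

Lemma is_derive_box_conv (k : 'I_n -> nat) (x : 'rV[R]_n) i :
  is_derive x (e_ i) (N k) (- N (incr_index i k) x).
Proof.
have mD := measurable_box bl bu.
pose f (t : R) (y : 'rV[R]_n) := c y * K k (t *: e_ i + x) y.
have dfE (t : R) (y : 'rV[R]_n) :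
    is_derive t 1 (f ^~ y : R -> R) (c y * - K (incr_index i k) (t *: e_ i + x) y).
  rewrite (_ : f ^~ y = c y *: (fun t : R => K k (t *: e_ i + x) y))//.
  by apply: is_deriveZ; exact: is_derive_multi_kernel.
have d1fE t y : partial1of2 f t y = - (c y * K (incr_index i k) (t *: e_ i + x) y).
  by rewrite partial1of2E -mulrN; have /@derive_val := dfE t y.
have [M M0 KM] := multi_kernel_bounded bl bu g sg (incr_index i k) x.
(* For [t] between -1 and 1 the point [t *: e_ i + x] is within distance 1 of [x], where [M] bounds
   the differentiated kernel. *)
have /= := @cvg_differentiation_under_integral R _ _ (lebesgue_rV n) f D mD
  0 (- 1) 1 _ _ _ (fun y => M * `|c y|) _ _ _.
have -> : \int[lebesgue_rV n]_(y in D) partial1of2 f 0 y = - N (incr_index i k) x.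
  under eq_Rintegral do rewrite d1fE scale0r add0r -mulN1r.
  by rewrite RintegralZl// ?mulN1r//; exact: integrable_box_conv.
move=> cvgN.
have {cvgN} cvgN : h^-1 *: (N k (h *: e_ i + x) - N k x) @[h --> 0^'] -->
    - N (incr_index i k) x.
  have E : (fun h : R => h^-1 *: (N k (h *: e_ i + x) - N k x)) =
    (fun h : R => h^-1 *: (\int[lebesgue_rV n]_(y in D) f (h + 0) y -
        \int[lebesgue_rV n]_(y in D) f 0 y)).
    by apply/funext => h; rewrite /f addr0 scale0r add0r.
  rewrite E; apply: cvgN.
  - by rewrite /= in_itv /= ltrN10 ltr01.
  - by move=> t _; exact: integrable_box_conv.
  - by move=> t y _ _; have /@ex_derive := dfE t y.
  - by move=> y; rewrite mulr_ge0.
  - exact: integrable_norm_scaled.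
  - move=> t y; rewrite /= in_itv /= => /andP[t1 t2] Dy.
    rewrite d1fE normrN normrM mulrC ler_wpM2r//; apply: KM => //.
    rewrite addrK [leLHS]/Num.Def.normr /= mx_normrE.
    apply/bigmax_leP; split=> // -[u v] _ /=.
    rewrite !mxE; case: (_ && _); rewrite ?mulr1 ?mulr0 ?normr0//.
    by rewrite ler_norml !ltW.
apply: DeriveDef; first by apply/cvg_ex; exists (- N (incr_index i k) x).
exact: cvg_lim.
Qed.

(** The scalar [r] strengthens the induction: it absorbs the sign produced by each differentiation,
    so that partial derivatives have again the same form. *)
Lemma box_conv_smooth (r : R) k : smooth (fun x => r * N k x).
Proof.
move=> m; elim: m r k => [|m IHm] r k /=; split => //.
1,2: by move=> x; apply: continuousM;
  [exact: cst_continuous|exact: (continuous_box_conv _ _ _ sg _ ic)].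
move=> i; have dN x : is_derive x (e_ i) (fun x => r * N k x)
    (- r * N (incr_index i k) x).
  rewrite (_ : - r * _ = r *: - N (incr_index i k) x); last first.
    by rewrite mulNr scalerN.
  by apply: (is_deriveZ (f := N k) r); exact: is_derive_box_conv.
split=> [x|]; first by have /@ex_derive := dN x.
rewrite (_ : partial i _ = fun x => - r * N (incr_index i k) x); first exact: IHm.
by apply/funext => x; have /@derive_val := dN x.
Qed.

End box_convolution_derive.

(** * Stability of the classes C^k under sums, products and inverses *)

Section smooth_algebra.
Context {R : realType} {n : nat}.
Implicit Types (f g : 'rV[R]_n -> R).

Lemma class_C_continuous k f : class_C k f -> continuous f.
Proof. by case: k => [|k] []. Qed.

Lemma class_CS k f : class_C k.+1 f -> class_C k f.
Proof.
elim: k f => [|k IHk] f [cf df]; first by split.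
by split=> // i; have [dfi Cfi] := df i; split => //; exact: IHk.
Qed.

Lemma class_C_add k f g : class_C k f -> class_C k g ->
  class_C k (fun x => f x + g x).
Proof.
elim: k f g => [|k IHk] f g Cf Cg.
  by split=> // x; apply: continuousD;
    [exact: (class_C_continuous _ _ Cf)|exact: (class_C_continuous _ _ Cg)].
split=> [x|i]; first by apply: continuousD;
    [exact: (class_C_continuous _ _ Cf)|exact: (class_C_continuous _ _ Cg)].
have [[_ /(_ i)[df Cfi]] [_ /(_ i)[dg Cgi]]] := (Cf, Cg).
split=> [x|]; first exact: derivableD.
rewrite (_ : partial i _ = fun x => partial i f x + partial i g x).
  exact: IHk.
by apply/funext => x; exact: deriveD.
Qed.

Lemma class_C_mul k f g : class_C k f -> class_C k g ->
  class_C k (fun x => f x * g x).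
Proof.
elim: k f g => [|k IHk] f g Cf Cg.
  by split=> // x; apply: continuousM;
    [exact: (class_C_continuous _ _ Cf)|exact: (class_C_continuous _ _ Cg)].
split=> [x|i]; first by apply: continuousM;
    [exact: (class_C_continuous _ _ Cf)|exact: (class_C_continuous _ _ Cg)].
have [[_ /(_ i)[df Cfi]] [_ /(_ i)[dg Cgi]]] := (Cf, Cg).
split=> [x|]; first exact: derivableM.
rewrite (_ : partial i _ = fun x => f x * partial i g x + g x * partial i f x);
  last first.
  by apply/funext => x; exact: deriveM.
by apply: class_C_add; apply: IHk => //; exact: class_CS.
Qed.

(** The derivative of [1 / f] involves [1 / f] itself, but at one order less, which the induction
    hypothesis supplies; products then finish the step. *)
Lemma class_C_inv k f : (forall x, f x != 0) -> class_C k f ->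
  class_C k (fun x => (f x)^-1).
Proof.
move=> f0; elim: k => [|k IHk] Cf.
  by split=> // x; apply: continuousV;
    [exact: f0|exact: (class_C_continuous _ _ Cf)].
split=> [x|i]; first by apply: continuousV;
    [exact: f0|exact: (class_C_continuous _ _ Cf)].
have CVf := IHk (class_CS _ _ Cf).
have [_ /(_ i)[df Cfi]] := Cf.
split=> [x|]; first exact: derivableV.
(* The sign is written as a factor [- 1], a constant function, so that stability under products
   suffices. *)
rewrite (_ : partial i _ = fun x =>
  - 1 * (((f x)^-1 * (f x)^-1) * partial i f x)); last first.
  apply/funext => x; rewrite /partial deriveV//.
  by rewrite mulN1r scaleNr -[_ *: _]/(_ * _) expr2 invfM.
apply: class_C_mul; last by apply: class_C_mul => //; exact: class_C_mul.
have constC (a : R) m : class_C m (fun _ : 'rV[R]_n => a).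
  elim: m a => [|m IHm] a; split=> //; try by move=> x; exact: cst_continuous.
  move=> j; split=> [x|]; first exact: derivable_cst.
  rewrite (_ : partial j _ = fun=> 0); first exact: IHm.
  by apply/funext => x; exact: derive_cst.
exact: constC.
Qed.

End smooth_algebra.

(** * Derivatives of the one-dimensional Gaussian kernel *)

Section gauss_kernel_calculus.
Context {R : realType}.
Variable beta : R.
Hypothesis beta0 : 0 < beta.
Local Notation gk := (gauss_kernel beta).

Lemma is_derive_phi (t : R) : is_derive t 1 (@phi R) (- (t * phi t)).
Proof.
rewrite [X in is_derive _ _ X _](_ : _ = normal_peak 1 *:
  (expR \o (- 2^-1 *: (id * id : R -> R)))); last first.
  apply/funext => s; rewrite phiE /=; congr (_ * expR _).
  by rewrite -[RHS]/(- 2^-1 * (s * s)); field.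
apply: (is_derive_eq (f' := normal_peak 1 *:
  (expR (- 2^-1 * (t * t)) * (- 2^-1 *: (t *: 1 + t *: 1))))).
rewrite phiE /= -![_ *: _]/(_ * _) (_ : - (t ^+ 2 / 2) = - 2^-1 * (t * t));
  by field.
Qed.

Lemma is_derive_gauss_kernel (t : R) : is_derive t 1 gk (- (t / beta ^+ 2) * gk t).
Proof.
have b0 : beta != 0 by rewrite gt_eqF.
rewrite [X in is_derive _ _ X _](_ : _ = beta^-1 *:
  (@phi R \o (beta^-1 *: (id : R -> R)))); last first.
  by apply/funext => s; rewrite /gauss_kernel /= mulrC;
    congr (_ * phi _); rewrite mulrC.
have dphi := is_derive_phi (beta^-1 * t).
apply: (is_derive_eq (f' := beta^-1 *:
  (- ((beta^-1 * t) * phi (beta^-1 * t)) * (beta^-1 *: 1)))).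
by rewrite /gauss_kernel -![_ *: _]/(_ * _) (mulrC t beta^-1); field.
Qed.

(** Up to sign and scaling the polynomials are those of Hermite; their existence alone makes every
    derivative differentiable again. *)
Lemma gauss_kernel_derive1n k : exists p : {poly R},
  gk^`(k)%classic = (fun t => p.[t] * gk t) :> (R -> R).
Proof.
elim: k => [|k [p IHk]].
  by exists 1; apply/funext => t; rewrite hornerC mul1r.
exists (p^`() - beta ^- 2 *: (p * 'X)); apply/funext => t.
rewrite derive1nS IHk derive1E.
have dgk := is_derive_gauss_kernel t.
rewrite (_ : (fun t => _) = horner p * gk)//.
rewrite (@derive_val _ _ _ _ _ _ _ (is_deriveM (is_derive_poly p t) dgk)).
rewrite -![_ *: _]/(_ * _).
rewrite !(hornerD, hornerN, hornerZ, hornerM, hornerX).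
by field; rewrite gt_eqF.
Qed.

Lemma gauss_kernel_smooth1 : smooth1 gk.
Proof.
move=> k t; have [p ->] := gauss_kernel_derive1n k.
have dgk := is_derive_gauss_kernel t.
apply: (@derivableM _ _ (horner p) gk); first exact: derivable_horner.
exact: ex_derive.
Qed.

End gauss_kernel_calculus.

(** * Integrals of product functions over a box *)

Section box_product.
Context {R : realType} {n : nat}.
Variables (bl bu : 'rV[R]_n).
Local Notation D := (box bl bu).

(** The indicator of a box is itself a product: each factor is cut off outside its own interval, and
    off the box at least one of the resulting factors [q i] vanishes. *)
Lemma ge0_integral_box_prod (p : 'I_n -> R -> R) :
  (forall i, measurable_fun [set: measurableTypeR R]
    (p i : _ -> measurableTypeR R)) ->
  (forall i t, bl ord0 i <= t <= bu ord0 i -> 0 <= p i t) ->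
  (\int[lebesgue_rV n]_(y in D) (\prod_i p i (y ord0 i))%:E =
   \prod_i \int[@lebesgue_measure R]_(t in `[bl ord0 i, bu ord0 i]) (p i t)%:E)%E.
Proof.
move=> mp p0.
pose q i : R -> R := p i \_ `[bl ord0 i, bu ord0 i].
transitivity (\int[lebesgue_rV n]_y (\prod_i q i (y ord0 i))%:E)%E.
  rewrite integral_mkcond; apply: eq_integral => y _; rewrite patchE.
  case: ifPn => [/set_mem Dy|nDy].
    congr EFin; apply: eq_bigr => i _; rewrite /q patchE mem_set//=.
    by rewrite in_itv /=; exact: Dy.
  have [i nDi] : exists i, ~~ (bl ord0 i <= y ord0 i <= bu ord0 i).
    apply/existsP; rewrite -negb_forall; apply: contra nDy => /forallP Dy.
    exact/mem_set.
  rewrite (bigD1 i)//= {1}/q patchE memNset ?mul0r//=.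
  by rewrite in_itv /=; exact/negP.
rewrite ge0_integral_power_measure_prod; first last.
- move=> i t; rewrite /q patchE; case: ifPn => // /set_mem /=.
  by rewrite in_itv /= => /p0.
- move=> i; apply/(measurable_restrictT _ _).1 => //.
  exact: measurable_funTS.
apply: eq_bigr => i _; rewrite [RHS]integral_mkcond.
by apply: eq_integral => t _; rewrite /q !patchE; case: ifP.
Qed.

Lemma continuous_itv_integrable (f : R -> R) (a b : R) : continuous f ->
  (@lebesgue_measure R).-integrable `[a, b] (EFin \o f).
Proof.
move=> cf; apply: continuous_compact_integrable; first exact: segment_compact.
exact: continuous_subspaceT.
Qed.

Lemma box_prod_integrable (p : 'I_n -> R -> R) : (forall i, continuous (p i)) ->
  (forall i t, bl ord0 i <= t <= bu ord0 i -> 0 <= p i t) ->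
  (lebesgue_rV n).-integrable D (fun y => (\prod_i p i (y ord0 i))%:E) /\
  \int[lebesgue_rV n]_(y in D) (\prod_i p i (y ord0 i)) =
  \prod_i \int[@lebesgue_measure R]_(t in `[bl ord0 i, bu ord0 i]) p i t.
Proof.
move=> cp p0.
have mp i : measurable_fun [set: measurableTypeR R] (p i : _ -> measurableTypeR R).
  exact: continuous_measurable_fun (cp i).
have E : (\int[lebesgue_rV n]_(y in D) (\prod_i p i (y ord0 i))%:E =
    (\prod_i \int[@lebesgue_measure R]_(t in `[bl ord0 i, bu ord0 i]) p i t)%:E)%E.
  rewrite ge0_integral_box_prod// -prodEFin; apply: eq_bigr => i _.
  rewrite fineK//; apply: integrable_fin_num => //.
  exact: continuous_itv_integrable.
split; last by rewrite /Rintegral E.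
apply/integrableP; split.
  by apply/measurable_EFinP/measurable_funTS; exact: measurable_prod_coord.
rewrite (eq_integral (fun y : 'rV[R]_n => (\prod_i p i (y ord0 i))%:E)).
  by rewrite E ltry.
move=> y /set_mem Dy; rewrite /= ger0_norm// prodr_ge0// => i _.
by apply: p0; exact: Dy.
Qed.

Lemma lebesgue_rV_box_integrable_cst (r : R) :
  (lebesgue_rV n).-integrable D (EFin \o (fun=> r)).
Proof.
have [i1 _] := box_prod_integrable (fun=> fun=> 1) (fun=> @cst_continuous R R 1)
  (fun _ _ _ => ler01).
rewrite (_ : EFin \o _ = fun y : 'rV[R]_n => (r%:E * (\prod_(i < n) 1)%:E)%E).
  by apply: integrableZl => //; exact: measurable_box.
by apply/funext => y; rewrite big1_eq mule1.
Qed.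

(** The minimum of [f] on the segment is attained, hence positive, and the segment has positive
    length. *)
Lemma Rintegral_itv_gt0 (f : R -> R) (a b : R) : a < b -> continuous f ->
  (forall t, 0 < f t) -> 0 < \int[@lebesgue_measure R]_(t in `[a, b]) f t.
Proof.
move=> ab cf f0; have [m _ fm] := EVT_min (ltW ab) (continuous_subspaceT cf).
apply: (@lt_le_trans _ _ (\int[@lebesgue_measure R]_(t in `[a, b]) f m)).
  rewrite Rintegral_cst// mulr_gt0 ?f0//.
  have ab_measure : ((@lebesgue_measure R) `[a, b]%classic = (b - a)%:E)%E.
    by rewrite lebesgue_measure_itv /= lte_fin ab.
  suff : 0 < fine ((@lebesgue_measure R) `[a, b]%classic) by [].
  by rewrite ab_measure subr_gt0.
apply: le_Rintegral => //.
  by apply: continuous_itv_integrable => t; exact: cst_continuous.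
exact: continuous_itv_integrable.
Qed.

End box_product.

(** * Means of truncated Gaussian vectors *)

(* The mean of [h (x + beta *: u)] for a truncated Gaussian vector [u]. *)
Definition box_mean {R : realType} {n : nat} (bl bu : 'rV[R]_n) (beta : R)
    (h : 'rV[R]_n -> R) (x : 'rV[R]_n) : R :=
  (\int[lebesgue_rV n]_(y in box bl bu) (h y * box_kernel beta x y)) /
  (\int[lebesgue_rV n]_(y in box bl bu) box_kernel beta x y).

Section box_mean_theory.
Context {R : realType} {n : nat}.
Variables (bl bu : 'rV[R]_n) (beta : R).
Hypotheses (hb : forall i, bl ord0 i < bu ord0 i) (beta0 : 0 < beta).
Local Notation D := (box bl bu).
Local Notation K := (@box_kernel R n beta).
Local Notation lambda := (lebesgue_rV n).
Local Notation E := (box_mean bl bu beta).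
Local Notation Z x := (\int[lambda]_(y in D) K x y).
Local Notation gk := (gauss_kernel beta).
Implicit Types (x y : 'rV[R]_n) (f g : R -> R) (h : 'rV[R]_n -> R).
Let mD : measurable D := measurable_box bl bu.
Let integrable_h (h : 'rV[R]_n -> R) := lambda.-integrable D (EFin \o h).

Lemma continuous_gauss_kernel_sub (c : R) : continuous (fun t => gk (t - c)).
Proof.
move=> t; apply: (continuous_comp (f := fun t => t - c) (g := gk)).
  by apply: continuousB; [exact: cvg_id|exact: cst_continuous].
exact: (smooth1_continuous _ 0 (gauss_kernel_smooth1 beta beta0)).
Qed.

Lemma continuous_mul_gauss_kernel f (c : R) :
  continuous f -> continuous (fun t => f t * gk (t - c)).
Proof.
move=> cf t; apply: cvgM; [exact: cf|exact: continuous_gauss_kernel_sub].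
Qed.

Lemma integrable_mul_kernel h x : integrable_h h ->
  lambda.-integrable D (fun y => (h y * K x y)%:E).
Proof.
move=> ih.
exact: (integrable_box_conv _ _ _ (gauss_kernel_smooth1 beta beta0)
  _ ih (fun=> 0%N)).
Qed.

Lemma integrable_kernel x : lambda.-integrable D (EFin \o K x).
Proof.
rewrite (_ : _ \o _ = fun y => (1 * K x y)%:E).
  by apply: integrable_mul_kernel; exact: lebesgue_rV_box_integrable_cst.
by apply/funext => y; rewrite /= mul1r.
Qed.

Lemma box_kernel_integralE x :
  Z x = \prod_i \int[@lebesgue_measure R]_(t in `[bl ord0 i, bu ord0 i])
    gk (t - x ord0 i).
Proof.
have [||_ <-] := box_prod_integrable bl bu (fun i t => gk (t - x ord0 i)) => //.
- by move=> i; exact: continuous_gauss_kernel_sub.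
- by move=> i t _; exact/ltW/gauss_kernel_gt0.
Qed.

Lemma gauss_itv_gt0 x i :
  0 < \int[@lebesgue_measure R]_(t in `[bl ord0 i, bu ord0 i]) gk (t - x ord0 i).
Proof.
apply: Rintegral_itv_gt0 => //; first exact: continuous_gauss_kernel_sub.
by move=> t; exact: gauss_kernel_gt0.
Qed.

Lemma box_kernel_integral_gt0 x : 0 < Z x.
Proof.
by rewrite box_kernel_integralE prodr_gt0// => i _; exact: gauss_itv_gt0.
Qed.

Lemma integrable_EFinD (f h : 'rV[R]_n -> R) : integrable_h f -> integrable_h h ->
  integrable_h (fun y => f y + h y).
Proof.
move=> i_f ih; rewrite /integrable_h /comp; under eq_fun do rewrite EFinD.
exact: integrableD.
Qed.

Lemma integrable_EFinZ r h : integrable_h h -> integrable_h (fun y => r * h y).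
Proof.
move=> ih; rewrite /integrable_h /comp; under eq_fun do rewrite EFinM.
exact: integrableZl.
Qed.

Lemma box_meanD (f h : 'rV[R]_n -> R) x : integrable_h f -> integrable_h h ->
  E (fun y => f y + h y) x = E f x + E h x.
Proof.
move=> i_f ih; rewrite /box_mean -mulrDl; congr (_ / _).
under eq_Rintegral do rewrite mulrDl.
by rewrite RintegralD//; exact: integrable_mul_kernel.
Qed.

Lemma box_meanZ r h x : integrable_h h -> E (fun y => r * h y) x = r * E h x.
Proof.
move=> ih; rewrite /box_mean mulrA; congr (_ / _).
under eq_Rintegral do rewrite -mulrA.
by rewrite RintegralZl//; exact: integrable_mul_kernel.
Qed.

Lemma box_mean_cst r x : E (fun=> r) x = r.
Proof.
rewrite /box_mean RintegralZl//; last exact: integrable_kernel.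
by rewrite mulfK// gt_eqF// box_kernel_integral_gt0.
Qed.

Lemma ler_box_mean (f h : 'rV[R]_n -> R) x : integrable_h f -> integrable_h h ->
  (forall y, D y -> f y <= h y) -> E f x <= E h x.
Proof.
move=> i_f ih fh; rewrite /box_mean ler_pM2r ?invr_gt0 ?box_kernel_integral_gt0//.
apply: le_Rintegral => //; [exact: integrable_mul_kernel..|].
by move=> y Dy; rewrite ler_wpM2r ?fh// ltW// box_kernel_gt0.
Qed.

Lemma ler_norm_box_mean h x : integrable_h h ->
  `|E h x| <= E (fun y => `|h y|) x.
Proof.
move=> ih; rewrite ler_norml -mulN1r -box_meanZ; last exact: integrable_norm.
apply/andP; split; apply: ler_box_mean => //.
- by apply: integrable_EFinZ; exact: integrable_norm.
- by move=> y _; rewrite mulN1r lerNl -normrN ler_norm.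
- exact: integrable_norm.
- by move=> y _; exact: ler_norm.
Qed.

Lemma integrable_mul_coord (f : R -> R) h i : continuous f -> integrable_h h ->
  integrable_h (fun y => h y * f (y ord0 i)).
Proof.
move=> cf ih.
have [M M0 fM] := continuous_segment_bounded f (`|bl ord0 i| + `|bu ord0 i|) cf.
apply: (@integrableMl _ _ _ _ _ mD (EFin \o h) (fun y => f (y ord0 i)) ih).
  apply: measurable_funTS; apply: measurableT_comp (@measurable_coord R n i).
  exact: continuous_measurable_fun.
exists M; split; first exact: num_real.
move=> M' MM' y /(_ i)/andP[ly yu]; apply: le_trans (ltW MM'); apply: fM.
rewrite ler_norml; have := ler_norm (bu ord0 i).
have := lerNnormlW (lexx `|bl ord0 i|).
have := normr_ge0 (bu ord0 i); have := normr_ge0 (bl ord0 i).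
by move=> *; apply/andP; split; lra.
Qed.

Lemma integrable_coord (f : R -> R) i : continuous f ->
  integrable_h (fun y => f (y ord0 i)).
Proof.
move=> cf; rewrite (_ : (fun _ => _) = fun y : 'rV[R]_n => 1 * f (y ord0 i)).
  by apply: integrable_mul_coord => //; exact: lebesgue_rV_box_integrable_cst.
by apply/funext => y; rewrite mul1r.
Qed.

(** Independence of the coordinates: the integrals along the other axes are the same in numerator
    and denominator, and cancel. *)
Lemma box_mean_coord (f : R -> R) i x : continuous f ->
  E (fun y => f (y ord0 i)) x =
  (\int[@lebesgue_measure R]_(t in `[bl ord0 i, bu ord0 i])
     (f t * gk (t - x ord0 i))) /
  (\int[@lebesgue_measure R]_(t in `[bl ord0 i, bu ord0 i]) gk (t - x ord0 i)).
Proof.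
move=> cf; set I := \int[_]_(t in _) gk _.
have I0 : I != 0 by rewrite gt_eqF// gauss_itv_gt0.
(* The product formula is stated for nonnegative factors. Adding to [f] a bound [M] of its absolute
   value on the segment shifts both sides by [M]. *)
wlog f0 : f cf / forall t, bl ord0 i <= t <= bu ord0 i -> 0 <= f t.
  move=> wlg.
  have [M M0 fM] := continuous_segment_bounded f (`|bl ord0 i| + `|bu ord0 i|) cf.
  have cfM : continuous (fun t => f t + M).
    by move=> t; apply: continuousD; [exact: cf|exact: cst_continuous].
  have := wlg _ cfM; rewrite box_meanD; last 2 first.
  - exact: integrable_coord.
  - exact: lebesgue_rV_box_integrable_cst.
  rewrite box_mean_cst; under eq_Rintegral do rewrite mulrDl.
  rewrite RintegralD//; last 2 first.
  - exact: continuous_itv_integrable (continuous_mul_gauss_kernel _ _ cf).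
  - apply: continuous_itv_integrable.
    by apply: (continuous_mul_gauss_kernel (fun=> M)) => t; exact: cst_continuous.
  rewrite RintegralZl//; last first.
    by apply: continuous_itv_integrable; exact: continuous_gauss_kernel_sub.
  rewrite mulrDl mulfK// => /(_ _)/addIr; apply=> t /andP[lt tu].
  have : `|f t| <= M.
    apply: fM; rewrite ler_norml; have := ler_norm (bu ord0 i).
    have := lerNnormlW (lexx `|bl ord0 i|).
    have := normr_ge0 (bu ord0 i); have := normr_ge0 (bl ord0 i).
    by move=> *; apply/andP; split; lra.
  by rewrite ler_norml => /andP[? _]; lra.
pose p j t := (if j == i then f t else 1) * gk (t - x ord0 j).
have [||_ pE] := box_prod_integrable bl bu p.
- move=> j; apply: continuous_mul_gauss_kernel => t.
  by case: eqVneq => _; [exact: cf|exact: cst_continuous].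
- move=> j t lt; rewrite mulr_ge0//; last exact/ltW/gauss_kernel_gt0.
  by case: eqVneq lt => [->|] // /f0.
rewrite /box_mean box_kernel_integralE.
rewrite [X in X / _](_ : _ = \int[lambda]_(y in D) (\prod_j p j (y ord0 j)));
  last first.
  apply: eq_Rintegral => y _; rewrite /p big_split /= -/(K x y); congr (_ * _).
  by rewrite (bigD1 i)//= eqxx big1 ?mulr1// => j /negbTE ->.
rewrite pE (bigD1 i)//= [in X in _ / X](bigD1 i)//= -/I /p eqxx.
rewrite (eq_bigr (fun j => \int[@lebesgue_measure R]_(t in `[bl ord0 j, bu ord0 j])
    gk (t - x ord0 j))); last first.
  by move=> j /negbTE ->; apply: eq_Rintegral => t _; rewrite mul1r.
rewrite invfM mulrACA divff ?mulr1// gt_eqF// prodr_gt0// => j _.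
exact: gauss_itv_gt0.
Qed.

End box_mean_theory.

(** * Moments of the one-dimensional Gaussian kernel on an interval *)

Lemma Rintegral_FTC2 {R : realType} (f F : R -> R) (a b : R) : a < b ->
  continuous f -> (forall t : R, is_derive t 1 F (f t)) ->
  \int[@lebesgue_measure R]_(t in `[a, b]) f t = F b - F a.
Proof.
move=> ab cf dF.
have cF : continuous F.
  move=> t; apply: differentiable_continuous; apply/derivable1_diffP.
  by have /@ex_derive := dF t.
rewrite /Rintegral (continuous_FTC2 (F := F) ab)//.
- exact: continuous_subspaceT.
- split; first by move=> t _; have /@ex_derive := dF t.
  + by apply: cvg_at_right_filter; exact: cF.
  + by apply: cvg_at_left_filter; exact: cF.
- by move=> t _; rewrite derive1E; have /@derive_val := dF t.
Qed.

Section gauss_moments.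
Context {R : realType}.
Variables (beta c : R).
Hypothesis beta0 : 0 < beta.
Local Notation gk := (gauss_kernel beta).
Local Notation w t := ((t - c) / beta).

Lemma is_derive_standardize (t : R) : is_derive t 1 (fun s => w s) beta^-1.
Proof.
rewrite (_ : (fun s => _) = beta^-1 *: ((id : R -> R) - cst c)); last first.
  by apply/funext => s; rewrite mulrC.
have d : is_derive t 1 (beta^-1 *: ((id : R -> R) - cst c)) (beta^-1 *: (1 - 0)).
  exact: is_deriveZ.
by apply: is_derive_eq d _; rewrite subr0 -[LHS]/(_ * _) mulr1.
Qed.

Lemma is_derive_phi_standardize (t : R) :
  is_derive t 1 (fun s => phi (w s)) (- (w t * gk (t - c))).
Proof.
have dw := is_derive_standardize t; have dphi := is_derive_phi (w t).
have := is_derive1_comp (f := phi) (g := fun s => w s) dphi dw.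
by move/is_derive_eq; apply; rewrite /gauss_kernel; ring.
Qed.

Lemma continuous_standardize : continuous (fun t : R => w t).
Proof.
move=> t; apply: differentiable_continuous; apply/derivable1_diffP.
by have /@ex_derive := is_derive_standardize t.
Qed.

Lemma gauss_first_moment (a b : R) : a < b ->
  \int[@lebesgue_measure R]_(t in `[a, b]) (w t * gk (t - c)) =
  phi (w a) - phi (w b).
Proof.
move=> ab.
have dF (t : R) : is_derive t 1 (- (fun s => phi (w s))) (w t * gk (t - c)).
  rewrite -[X in is_derive _ _ _ X]opprK.
  by apply: is_deriveN; exact: is_derive_phi_standardize.
rewrite (Rintegral_FTC2 _ _ _ _ ab _ dF).
  by rewrite -[LHS]/(- phi (w b) - - phi (w a)) opprK addrC.
exact: continuous_mul_gauss_kernel beta0 _ _ continuous_standardize.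
Qed.

(** The difference of the two integrands has [- w t * phi (w t)] as antiderivative. Since [c] lies
    between [a] and [b], [w a <= 0 <= w b], so both boundary terms have the favourable sign. *)
Lemma gauss_second_moment (a b : R) : a <= c <= b -> a < b ->
  \int[@lebesgue_measure R]_(t in `[a, b]) (w t ^+ 2 * gk (t - c)) <=
  \int[@lebesgue_measure R]_(t in `[a, b]) gk (t - c).
Proof.
move=> /andP[ac cb] ab; rewrite -subr_le0.
have cw2 : continuous (fun t : R => w t ^+ 2).
  by move=> t; apply: cvgM; exact: continuous_standardize.
have cwg := continuous_mul_gauss_kernel _ beta0 _ c cw2.
rewrite -RintegralB//; last 2 first.
- exact: continuous_itv_integrable.
- exact: continuous_itv_integrable (continuous_gauss_kernel_sub _ beta0 c).
have dF (t : R) : is_derive t 1 (- ((fun s => w s) * (fun s => phi (w s))))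
    (w t ^+ 2 * gk (t - c) - gk (t - c)).
  have dw := is_derive_standardize t.
  have dphi := is_derive_phi_standardize t.
  have := is_deriveN (is_deriveM dw dphi).
  by move/is_derive_eq; apply; rewrite /gauss_kernel -![_ *: _]/(_ * _); ring.
rewrite (Rintegral_FTC2 _ _ _ _ ab _ dF); last first.
  move=> t; apply: cvgB; first exact: cwg.
  exact: continuous_gauss_kernel_sub.
rewrite -[X in X <= _]/(- (w b * phi (w b)) - - (w a * phi (w a))).
have wb : 0 <= w b by rewrite divr_ge0 ?subr_ge0// ltW.
have wa : w a <= 0 by rewrite ler_pdivrMr// mul0r subr_le0.
rewrite opprK addrC subr_le0 (@le_trans _ _ 0)//.
  by rewrite mulr_le0_ge0// phi_ge0.
by rewrite mulr_ge0// phi_ge0.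
Qed.

Lemma Phi_sub (a b : R) : a < b ->
  Phi (w b) - Phi (w a) =
  \int[@lebesgue_measure R]_(t in `[a, b]) gk (t - c).
Proof.
move=> ab.
have wab : w a <= w b by rewrite ler_pM2r ?invr_gt0// lerD2r ltW.
have PhiE t : Phi t = \int[@lebesgue_measure R]_(s in `]-oo, t]) phi s by [].
rewrite !PhiE Rintegral_itvB; last 3 first.
- by apply: integrableS (integrable_normal_pdf 0 1).
- by [].
- by rewrite bnd_simp.
rewrite Rintegral_itv_obnd_cbnd; last first.
  apply: integrableS (integrable_normal_pdf 0 1) => //.
congr fine.
have mg : measurable_fun [set: measurableTypeR R] (fun t => (gk (t - c))%:E).
  by apply/measurable_EFinP; exact: measurable_gauss_kernel.
(* Under the substitution of [c + beta * t] for the variable, the Jacobian [beta] cancels the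
   division by [beta] in [gauss_kernel]. *)
rewrite [RHS]integral_mkcond [RHS](ge0_integral_affine c beta); last 3 first.
- by rewrite gt_eqF.
- by apply/(measurable_restrictT _ _).1 => //; exact: measurable_funTS.
- by apply: erestrict_ge0 => t _; rewrite lee_fin ltW// gauss_kernel_gt0.
rewrite integral_mkcond -ge0_integralZl//; last 2 first.
- apply: (measurableT_comp (f := (fun t => (gk (t - c))%:E) \_ `[a, b])).
    by apply/(measurable_restrictT _ _).1 => //; exact: measurable_funTS.
  by apply: measurable_funD => //; exact: measurable_funM.
- by move=> t _; apply: erestrict_ge0 => s _;
    rewrite lee_fin ltW// gauss_kernel_gt0.
apply: eq_integral => t _; rewrite !patchE.
rewrite (_ : (c + beta * t \in `[a, b]%classic) = (t \in `[w a, w b]%classic)).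
  case: ifPn => _; last by rewrite mule0.
  rewrite -EFinM /gauss_kernel addrAC subrr add0r gtr0_norm//.
  by rewrite [beta * t]mulrC mulfK ?gt_eqF// mulrC divfK// gt_eqF.
apply/idP/idP => /set_mem /=; rewrite in_itv /= => /andP[h1 h2];
  apply/mem_set => /=;
  rewrite in_itv /=; move: h1 h2; rewrite ler_pdivrMr// ler_pdivlMr// (mulrC t);
  by rewrite lerBlDl lerBrDl => -> ->.
Qed.

End gauss_moments.

(** * Box means as truncated Gaussian expectations, and their gradient *)

Section truncated_gaussian_mean.
Context {R : realType} {n : nat}.
Variables (bl bu : 'rV[R]_n) (beta : R).
Hypotheses (hb : forall i, bl ord0 i < bu ord0 i) (beta0 : 0 < beta).
Implicit Types (x y : 'rV[R]_n) (h c : 'rV[R]_n -> R).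
Local Notation D := (box bl bu).
Local Notation K := (@box_kernel R n beta).
Local Notation lambda := (lebesgue_rV n).
Local Notation E := (box_mean bl bu beta).
Local Notation Z x := (\int[lambda]_(y in D) K x y).
Let mD : measurable D := measurable_box bl bu.
Let ibd := lebesgue_rV_box_integrable_cst bl bu.

Section change.
Variables (s : R) (a b x : 'rV[R]_n).
Hypotheses (sb : `|s| = beta).
Hypothesis boxE : forall u, box a b u <-> D (x + s *: u).

Lemma measurable_affine_rV : measurable_fun [set: 'rV[R]_n]
  (fun u : 'rV[R]_n => x + s *: u).
Proof.
apply/measurable_fun_coordP => i; under eq_fun do rewrite !mxE.
by apply: measurable_funD => //; apply: measurable_funM => //;
  exact: measurable_coord.
Qed.

Lemma fine_std_gaussian_box : fine (std_gaussian n (box a b)) = Z x.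
Proof. by rewrite (std_gaussian_boxE beta s bl bu a b x). Qed.

Lemma box_mean_weight h : lambda.-integrable D (EFin \o h) ->
  lambda.-integrable D (fun y => (h y * (K x y / Z x))%:E) /\
  (\int[lambda]_(y in D) (h y * (K x y / Z x))%:E = (E h x)%:E)%E.
Proof.
move=> ih; have ihK := integrable_mul_kernel bl bu beta beta0 h x ih.
have EE : (fun y => (h y * (K x y / Z x))%:E) =
    (fun y => (Z x)^-1%:E * (h y * K x y)%:E)%E.
  by apply/funext => y; rewrite -EFinM mulrA mulrC.
rewrite EE; split; first exact: integrableZl.
rewrite integralZl// /box_mean /Rintegral mulrC EFinM fineK//.
exact: integrable_fin_num.
Qed.

Lemma box_weight_ge0 y : 0 <= K x y / Z x.
Proof.
by rewrite divr_ge0// ltW// ?box_kernel_gt0// box_kernel_integral_gt0.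
Qed.

Lemma integral_truncated_gaussian h : lambda.-integrable D (EFin \o h) ->
  \int[truncated_gaussian a b]_(u in box a b) h (x + s *: u) = E h x.
Proof.
move=> ih; have [ihK ihE] := box_mean_weight h ih.
have [|||_ chE] := ge0_change_integrable _ _ _ _ (truncated_gaussian a b)
  lambda (box a b) D (fun u : 'rV[R]_n => x + s *: u) _ (measurable_box a b) mD
  (measurable_funTS measurable_affine_rV) _ box_weight_ge0 _ h _ ihK.
- by move=> u /boxE.
- move=> F mF F0; rewrite (ge0_integral_truncated_gaussian beta s bl bu)//.
  by rewrite fine_std_gaussian_box.
- by apply/measurable_EFinP; exact: measurable_int ih.
by rewrite /Rintegral chE ihE.
Qed.

(** With [s] equal to [beta] or to [- beta] the value is the same [E h x]; this handles [u2] without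
    computing the law of its opposite. *)
Lemma expectation_truncated_gaussian d (W : measurableType d)
    (P : probability W R) (u : {RV P >-> 'rV[R]_n}) h :
  has_truncated_gaussian_law u a b -> lambda.-integrable D (EFin \o h) ->
  P.-integrable setT (fun w => (h (x + s *: u w))%:E) /\
  ('E_P[fun w => h (x + s *: u w)%R] = (E h x)%:E)%E.
Proof.
move=> [ub lawu] ih; have [ihK ihE] := box_mean_weight h ih.
have mu : measurable_fun setT u by exact: measurable_funPT.
have [|||] := ge0_change_integrable _ _ _ _ P lambda setT D
  (fun w => x + s *: u w) _ measurableT mD
  (measurableT_comp measurable_affine_rV mu) _ box_weight_ge0 _ h _ ihK.
- by move=> w _; exact/boxE.
- move=> F mF F0; rewrite -fine_std_gaussian_box.
  rewrite -(ge0_integral_truncated_gaussian beta s bl bu)//.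
  have mG : measurable_fun setT (fun v : 'rV[R]_n => F (x + s *: v)).
    exact: measurableT_comp mF measurable_affine_rV.
  (* All values of [u] lie in the box, so cutting the integrand off outside it changes nothing along
     [u]. *)
  pose G := (fun v : 'rV[R]_n => F (x + s *: v)) \_ (box a b).
  transitivity (\int[P]_w (G \o u) w)%E.
    by apply: eq_integral => w _; rewrite /= /G patchE mem_set.
  rewrite -ge0_integral_distribution; last 2 first.
  - apply/(measurable_restrictT _ _).1; first exact: measurable_box.
    exact: measurable_funTS.
  - exact: erestrict_ge0.
  rewrite -integral_mkcond; apply: eq_measure_integral => A mA _.
  exact: lawu.
- by apply/measurable_EFinP; exact: measurable_int ih.
by move=> ? EE; split=> //; rewrite unlock EE.
Qed.

End change.

Lemma box_scaleE x u :
  box (beta^-1 *: (bl - x)) (beta^-1 *: (bu - x)) u <-> D (x + beta *: u).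
Proof.
split=> ub i; have := ub i; rewrite !mxE ![beta^-1 * _]mulrC ler_pdivrMr//
  ler_pdivlMr// (mulrC (u ord0 i)); by rewrite lerBlDl lerBrDl.
Qed.

Lemma box_scaleNE x u :
  box (beta^-1 *: (x - bu)) (beta^-1 *: (x - bl)) u <-> D (x + (- beta) *: u).
Proof.
split=> ub i; have := ub i; rewrite !mxE ![beta^-1 * _]mulrC ler_pdivrMr//
  ler_pdivlMr// (mulrC (u ord0 i)) => /andP[h1 h2]; apply/andP; split; lra.
Qed.

Lemma smoothingE c x : lambda.-integrable D (EFin \o c) ->
  smoothing bl bu beta c x = E c x.
Proof.
move=> ic; apply: integral_truncated_gaussian => //.
  by rewrite gtr0_norm.
exact: box_scaleE.
Qed.

Lemma kernel_integral_smooth c : lambda.-integrable D (EFin \o c) ->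
  smooth (fun x => \int[lambda]_(y in D) (c y * K x y)).
Proof.
move=> ic; rewrite (_ : (fun x => _) = fun x => 1 *
    box_conv bl bu (gauss_kernel beta) c (fun=> 0%N) x).
  by apply: box_conv_smooth => //; exact: gauss_kernel_smooth1.
by apply/funext => x; rewrite mul1r.
Qed.

(** The denominator is the numerator for the constant function 1, so smoothness and derivatives of
    numerators apply to it as well. *)
Lemma box_kernel_mul1 x : Z x = \int[lambda]_(y in D) (1 * K x y).
Proof. by apply: eq_Rintegral => y _; rewrite mul1r. Qed.

Lemma box_mean_smooth c : lambda.-integrable D (EFin \o c) -> smooth (E c).
Proof.
move=> ic k; apply: class_C_mul; first exact: kernel_integral_smooth.
apply: class_C_inv => [x|]; first by rewrite gt_eqF// box_kernel_integral_gt0.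
rewrite (_ : (fun x => _) = fun x => \int[lambda]_(y in D) (1 * K x y)).
  exact: kernel_integral_smooth.
by apply/funext => x; exact: box_kernel_mul1.
Qed.

Local Notation w x i := (fun y : 'rV[R]_n => (y ord0 i - x ord0 i) / beta).

Lemma integrable_std x i : lambda.-integrable D (EFin \o w x i).
Proof. exact: integrable_coord (continuous_standardize beta (x ord0 i)). Qed.

Lemma integrable_mul_std c x i : lambda.-integrable D (EFin \o c) ->
  lambda.-integrable D (EFin \o (fun y => c y * w x i y)).
Proof.
move=> ic.
exact: integrable_mul_coord (continuous_standardize beta (x ord0 i)) ic.
Qed.

Lemma is_derive_kernel_integral c x i : lambda.-integrable D (EFin \o c) ->
  is_derive x (delta_mx ord0 i) (fun x => \int[lambda]_(y in D) (c y * K x y))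
    (beta^-1 * \int[lambda]_(y in D) (c y * w x i y * K x y)).
Proof.
move=> ic.
have sgk := gauss_kernel_smooth1 beta beta0.
have := is_derive_box_conv bl bu _ sgk c ic (fun=> 0%N) x i.
move/is_derive_eq; apply.
rewrite -RintegralZl//; last exact/integrable_mul_kernel/integrable_mul_std.
rewrite /box_conv -mulN1r -RintegralZl//; last exact: integrable_box_conv.
apply: eq_Rintegral => y _.
rewrite mulN1r -mulrN [RHS]mulrCA -[in RHS]mulrA -[in RHS]mulrA; congr (_ * _).
(* Differentiating the factor [i] brings out minus the standardized displacement divided by [beta];
   this sign cancels the one in front of the derivative of the convolution. *)
rewrite /multi_kernel /box_kernel (bigD1 i)//= [in RHS](bigD1 i)//=.
rewrite {1}/incr_index eqxx add0n derive1n1 derive1E.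
have dgk := is_derive_gauss_kernel beta beta0 (y ord0 i - x ord0 i).
rewrite derive_val [X in _ * X](eq_bigr (fun j =>
  gauss_kernel beta (y ord0 j - x ord0 j))).
  by field; rewrite gt_eqF.
by move=> j /negbTE ji; rewrite /incr_index ji.
Qed.

(** The quotient rule produces the covariance of [c] and the standardized coordinate. *)
Lemma partial_box_mean c x i : lambda.-integrable D (EFin \o c) ->
  partial i (E c) x =
  beta^-1 * (E (fun y => c y * w x i y) x - E c x * E (w x i) x).
Proof.
move=> ic; have Z0 : Z x != 0 by rewrite gt_eqF// box_kernel_integral_gt0.
have dN := is_derive_kernel_integral c x i ic.
have dZ : is_derive x (delta_mx ord0 i) (fun x => Z x)
    (beta^-1 * \int[lambda]_(y in D) (w x i y * K x y)).
  rewrite (_ : (fun x => _) = fun x => \int[lambda]_(y in D) (1 * K x y)).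
    have := is_derive_kernel_integral _ x i (ibd 1).
    move/is_derive_eq; apply; congr (_ * _).
    by apply: eq_Rintegral => y _; rewrite mul1r.
  by apply/funext => z; exact: box_kernel_mul1.
rewrite /partial [X in 'D_ _ X _](_ : _ =
  (fun x => \int[lambda]_(y in D) (c y * K x y)) *
  (fun x => (Z x)^-1)) //.
rewrite deriveM//; last by apply: derivableV => //; have /@ex_derive := dZ.
rewrite deriveV//.
rewrite !derive_val -![_ *: _]/(_ * _) /box_mean /=.
by field; rewrite Z0 gt_eqF.
Qed.

(** The second factor is centred by the choice of [m], so the baseline [r] drops out of the mean and
    a covariance remains. The estimators take [c x] as baseline. *)
Lemma box_mean_estimator c x i (r m : R) : lambda.-integrable D (EFin \o c) ->
  m = E (w x i) x ->
  lambda.-integrable D (EFin \o (fun y => (c y - r) * (w x i y - m))) /\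
  E (fun y => (c y - r) * (w x i y - m)) x = beta * partial i (E c) x.
Proof.
move=> ic mE.
have icw := integrable_mul_std c x i ic; have iw := integrable_std x i.
have -> : (fun y => (c y - r) * (w x i y - m)) =
    fun y => (c y * w x i y + - m * c y) + (- r * w x i y + r * m).
  by apply/funext => y; ring.
have i1 : lambda.-integrable D (EFin \o (fun y => - m * c y)).
  exact: integrable_EFinZ.
have i2 : lambda.-integrable D (EFin \o (fun y => - r * w x i y)).
  exact: integrable_EFinZ.
have i3 := integrable_EFinD bl bu _ _ icw i1.
have i4 := integrable_EFinD bl bu _ _ i2 (ibd (r * m)).
split; first exact: integrable_EFinD.
rewrite !box_meanD// !box_meanZ// box_mean_cst// partial_box_mean// -mE.
by field; rewrite gt_eqF.
Qed.

End truncated_gaussian_mean.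

(** * Moments of the coordinates and the Lipschitz bound *)

Section box_mean_standard.
Context {R : realType} {n : nat}.
Variables (bl bu : 'rV[R]_n) (beta : R).
Hypotheses (hb : forall i, bl ord0 i < bu ord0 i) (beta0 : 0 < beta).
Local Notation E := (box_mean bl bu beta).
Local Notation D := (box bl bu).
Local Notation w x i := (fun y : 'rV[R]_n => (y ord0 i - x ord0 i) / beta).

Lemma box_mean_std (x : 'rV[R]_n) i : E (w x i) x =
  truncated_gaussian_mean (beta^-1 *: (bl - x)) (beta^-1 *: (bu - x)) ord0 i.
Proof.
rewrite (box_mean_coord _ _ _ hb beta0
  (fun t => (t - x ord0 i) / beta)); last first.
  exact: continuous_standardize.
rewrite gauss_first_moment// -Phi_sub// !mxE.
by rewrite ![beta^-1 * _]mulrC.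
Qed.

Lemma box_mean_sqr_std (x : 'rV[R]_n) i : D x -> E (fun y => w x i y ^+ 2) x <= 1.
Proof.
move=> Dx; rewrite (box_mean_coord _ _ _ hb beta0
  (fun t => ((t - x ord0 i) / beta) ^+ 2)).
  rewrite ler_pdivrMr ?mul1r ?gauss_itv_gt0//.
  by apply: gauss_second_moment => //; exact: Dx.
by move=> t; apply: cvgM; exact: continuous_standardize.
Qed.

Lemma box_mean_sum_sqr_std (x : 'rV[R]_n) : D x ->
  (lebesgue_rV n).-integrable D (EFin \o (fun y => \sum_i w x i y ^+ 2)) /\
  E (fun y => \sum_i w x i y ^+ 2) x <= n%:R.
Proof.
move=> Dx.
have iw i : (lebesgue_rV n).-integrable D (EFin \o (fun y => w x i y ^+ 2)).
  apply: (integrable_coord bl bu (fun t => ((t - x ord0 i) / beta) ^+ 2)).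
  by move=> t; apply: cvgM; exact: continuous_standardize.
(* Additivity of means is available for two terms, so the sum is built one index at a time over an
   arbitrary list. *)
suff H (r : seq 'I_n) : (lebesgue_rV n).-integrable D
      (EFin \o (fun y => \sum_(i <- r) w x i y ^+ 2)) /\
    E (fun y => \sum_(i <- r) w x i y ^+ 2) x <= (size r)%:R.
  have [isum] := H (index_enum 'I_n).
  suff -> : size (index_enum 'I_n) = n by [].
  by rewrite -count_predT -sum1_count sum1_card card_ord.
elim: r => [|i r [ir IHr]].
  have -> : (fun y : 'rV[R]_n => \sum_(j <- [::]) w x j y ^+ 2) = fun=> 0.
    by apply/funext => y; rewrite big_nil.
  split; first exact: lebesgue_rV_box_integrable_cst.
  by rewrite box_mean_cst.
have -> : (fun y : 'rV[R]_n => \sum_(j <- i :: r) w x j y ^+ 2) =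
    fun y => w x i y ^+ 2 + \sum_(j <- r) w x j y ^+ 2.
  by apply/funext => y; rewrite big_cons.
split; first exact: integrable_EFinD.
by rewrite box_meanD// /= -nat1r lerD// box_mean_sqr_std.
Qed.

(** The corners [bl] and [bu] are two distinct points of the box as soon as the dimension is
    positive; in dimension zero a negative [L] would be allowed. *)
Lemma lipschitz_norm2_ge0 (L : R) (c : 'rV[R]_n -> R) : (0 < n)%N ->
  lipschitz_norm2 L D c -> 0 <= L.
Proof.
case: n bl bu hb c => [//|m] l u lu c _ lip.
have Dl : box l u l by move=> i; rewrite lexx ltW.
have Du : box l u u by move=> i; rewrite lexx ltW.
have := le_trans (normr_ge0 _) (lip _ _ Du Dl).
rewrite pmulr_lge0// /norm2 sqrtr_gt0 big_ord_recl ltr_wpDr//.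
  by apply: sumr_ge0 => i _; exact: sqr_ge0.
by rewrite !mxE exprn_even_gt0//= subr_eq0 gt_eqF.
Qed.

(* The Euclidean norm [q] of a standardized displacement satisfies
   [q <= (q ^+ 2 / sqrt n + sqrt n) / 2], and [q ^+ 2] has mean at most [n]. *)
Lemma box_mean_lipschitz (L : R) (c : 'rV[R]_n -> R) (x : 'rV[R]_n) :
  (lebesgue_rV n).-integrable D (EFin \o c) ->
  lipschitz_norm2 L D c -> D x ->
  `|E c x - c x| <= L * beta * Num.sqrt n%:R.
Proof.
move=> ic lip Dx.
have icx := lebesgue_rV_box_integrable_cst bl bu (- c x).
have -> : E c x - c x = E (fun y => c y + - c x) x.
  by rewrite box_meanD// box_mean_cst.
have id := integrable_EFinD _ _ _ _ ic icx.
(* In dimension zero the space is one point and both sides vanish, whatever the sign of [L]. *)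
have [n0|n_gt0] := posnP n.
  have E0 : (fun y => c y + - c x) = fun=> 0.
    apply/funext => y; rewrite (_ : y = x) ?subrr//.
    by apply/rowP => i; move: (ltn_ord i); rewrite {2}n0.
  by rewrite E0 box_mean_cst// normr0 n0 sqrtr0 mulr0.
have Lb0 : 0 <= L * beta.
  by rewrite mulr_ge0 ?(ltW beta0)//; exact: lipschitz_norm2_ge0 lip.
set q := Num.sqrt n%:R; have q0 : 0 < q by rewrite sqrtr_gt0 ltr0n.
have qq : q ^+ 2 = n%:R by rewrite sqr_sqrtr.
apply: (le_trans (ler_norm_box_mean _ _ _ hb beta0 _ _ id)).
(* As [q ^+ 2] is [n], [A * n] equals [L * beta * q / 2]: the two terms of the majorant contribute
   equally and add up to the bound. *)
pose A := L * beta / (2 * q).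
have [isum Esum] := box_mean_sum_sqr_std x Dx.
have iA := integrable_EFinZ _ _ A _ isum.
have iB := lebesgue_rV_box_integrable_cst bl bu (L * beta * q / 2).
apply: (@le_trans _ _ (E (fun y =>
  A * (\sum_i w x i y ^+ 2) + L * beta * q / 2) x)).
  apply: ler_box_mean => //.
  - exact: integrable_norm.
  - exact: integrable_EFinD.
  move=> y Dy; apply: (le_trans (lip y x Dy Dx)).
  set S := \sum_i _; have S0 : 0 <= S by apply: sumr_ge0 => i _; exact: sqr_ge0.
  have -> : norm2 (y - x) = beta * Num.sqrt S.
    rewrite /norm2 (_ : \sum_i _ = beta ^+ 2 * S).
      by rewrite sqrtrM ?sqr_ge0// sqrtr_sqr gtr0_norm.
    rewrite mulr_sumr; apply: eq_bigr => i _; rewrite !mxE.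
    by field; rewrite gt_eqF.
  set s := Num.sqrt S; have s0 : 0 <= s by exact: sqrtr_ge0.
  have ss : s ^+ 2 = S by rewrite sqr_sqrtr.
  rewrite -ss -subr_ge0 (_ : _ - _ = L * beta * (s - q) ^+ 2 / (2 * q)).
    apply: divr_ge0; last by rewrite mulr_ge0// ltW.
    by apply: mulr_ge0; [exact: Lb0|exact: sqr_ge0].
  by rewrite /A; field; rewrite gt_eqF.
rewrite box_meanD// box_meanZ// box_mean_cst//.
apply: (@le_trans _ _ (A * n%:R + L * beta * q / 2)).
  rewrite lerD2r ler_wpM2l//; apply: divr_ge0; first exact: Lb0.
  by rewrite mulr_ge0// ltW.
rewrite (_ : _ + _ = L * beta * q)//.
by rewrite -qq /A; field; rewrite gt_eqF.
Qed.

End box_mean_standard.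

Theorem lemma3p1 (R : realType) (n : nat) (bl bu : 'rV[R]_n)
    (c : 'rV[R]_n -> R) (beta : R)
    (hb : forall i, bl ord0 i < bu ord0 i)
    (hc : (lebesgue_rV n).-integrable (box bl bu) (EFin \o c))
    (hbeta : 0 < beta) :
  [/\ smooth (smoothing bl bu beta c),
      forall (d : measure_display) (W : measurableType d)
        (P : probability W R) (x : 'rV[R]_n) (u : {RV P >-> 'rV[R]_n}),
        box bl bu x ->
        let a := beta^-1 *: (bl - x) in
        let b := beta^-1 *: (bu - x) in
        let mu := truncated_gaussian_mean a b in
        has_truncated_gaussian_law u a b ->
        has_mean P u mu /\
        has_mean P
          (fun w => beta^-1 *: (c (x + beta *: u w) *: (u w - mu)
                                - c x *: (u w - mu)))
          (gradient (smoothing bl bu beta c) x),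
      forall (d : measure_display) (W : measurableType d)
        (P : probability W R) (x : 'rV[R]_n) (u1 u2 : {RV P >-> 'rV[R]_n})
        (mu1 mu2 : 'rV[R]_n),
        box bl bu x ->
        has_truncated_gaussian_law u1
          (beta^-1 *: (bl - x)) (beta^-1 *: (bu - x)) ->
        has_truncated_gaussian_law u2
          (beta^-1 *: (x - bu)) (beta^-1 *: (x - bl)) ->
        has_mean P u1 mu1 ->
        has_mean P u2 mu2 ->
        has_mean P
          (fun w => (2 * beta)^-1 *:
             ((c (x + beta *: u1 w) - c x) *: (u1 w - mu1)
              - (c (x - beta *: u2 w) - c x) *: (u2 w - mu2)))
          (gradient (smoothing bl bu beta c) x) &
      forall L : R,
        lipschitz_norm2 L (box bl bu) c ->
        forall x : 'rV[R]_n, box bl bu x ->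
          `|smoothing bl bu beta c x - c x| <= L * beta * Num.sqrt n%:R].
Proof.
(* The identity holds at every point of the space, so the gradient at a boundary point of the box is
   an ordinary one. *)
have smE : smoothing bl bu beta c = box_mean bl bu beta c.
  by apply/funext => x; exact: smoothingE.
have bn : `|beta| = beta by rewrite gtr0_norm.
have bNn : `|- beta| = beta by rewrite normrN.
split.
- by rewrite smE; exact: box_mean_smooth.
- move=> d W P x u Dx a b mu lawu.
  have Eu i : mu ord0 i = box_mean bl bu beta
      (fun y => (y ord0 i - x ord0 i) / beta) x.
    by rewrite box_mean_std.
  have uE w i : ((x + beta *: u w) ord0 i - x ord0 i) / beta = u w ord0 i.
    by rewrite !mxE addrAC subrr add0r mulrC mulKf// gt_eqF.
  split=> i.
    have [iu EuE] := expectation_truncated_gaussian _ _ _ hb hbeta _ _ _ _ bn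
      (box_scaleE bl bu beta hbeta x) _ _ _ _ _ lawu
      (integrable_std bl bu beta x i).
    rewrite Eu -EuE; split; last first.
      by congr expectation; apply/funext => w; rewrite uE.
    by move: iu; under eq_fun do rewrite uE.
  have [ih Eh] := box_mean_estimator bl bu beta hb hbeta c x i (c x) _ hc (Eu i).
  have [ieh Eeh] := expectation_truncated_gaussian _ _ _ hb hbeta _ _ _ _ bn
    (box_scaleE bl bu beta hbeta x) _ _ _ _ _ lawu ih.
  have estE w : (beta^-1 *: (c (x + beta *: u w) *: (u w - mu) -
      c x *: (u w - mu))) ord0 i = beta^-1 * ((c (x + beta *: u w) - c x) *
      (((x + beta *: u w) ord0 i - x ord0 i) / beta - mu ord0 i)).
    by rewrite uE -scalerBl !mxE.
  rewrite (_ : (fun w => _) = fun w => beta^-1%:E * ((c (x + beta *: u w) - c x) *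
      (((x + beta *: u w) ord0 i - x ord0 i) / beta - mu ord0 i))%:E)%E; last first.
    by apply/funext => w; rewrite estE.
  split; first exact: integrableZl.
  rewrite smE mxE unlock; under eq_integral do rewrite estE EFinM.
  rewrite integralZl//; move: Eeh; rewrite unlock => ->.
  by rewrite Eh -EFinM mulKf// gt_eqF.
- move=> d W P x u1 u2 mu1 mu2 Dx law1 law2 mean1 mean2 i.
  pose m := box_mean bl bu beta (fun y => (y ord0 i - x ord0 i) / beta) x.
  have u1E w : ((x + beta *: u1 w) ord0 i - x ord0 i) / beta = u1 w ord0 i.
    by rewrite !mxE addrAC subrr add0r mulrC mulKf// gt_eqF.
  have u2E w : ((x + - beta *: u2 w) ord0 i - x ord0 i) / beta = - u2 w ord0 i.
    by rewrite !mxE addrAC subrr add0r mulNr mulNr mulrC mulKf// gt_eqF.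
  have iw := integrable_std bl bu beta x i.
  (* The vectors [mu1] and [mu2] are known only as means; uniqueness of the expectation gives their
     coordinates as [m] and [- m]. *)
  have m1 : mu1 ord0 i = m.
    have [_ E1] := expectation_truncated_gaussian _ _ _ hb hbeta _ _ _ _ bn
      (box_scaleE bl bu beta hbeta x) _ _ _ _ _ law1 iw.
    apply: EFin_inj; rewrite -E1 -(proj2 (mean1 i)).
    by congr expectation; apply/funext => w; rewrite u1E.
  have m2 : mu2 ord0 i = - m.
    have [iE2 E2] := expectation_truncated_gaussian _ _ _ hb hbeta _ _ _ _ bNn
      (box_scaleNE bl bu beta hbeta x) _ _ _ _ _ law2 iw.
    apply: EFin_inj; rewrite -(proj2 (mean2 i)) EFinN -E2 unlock.
    under [in RHS]eq_integral do rewrite u2E -mulN1r EFinM.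
    rewrite integralZl//; last by case: (mean2 i).
    by rewrite EFinN mulN1e oppeK.
  have [ih Eh] := box_mean_estimator bl bu beta hb hbeta c x i (c x) m hc erefl.
  have [i1 E1] := expectation_truncated_gaussian _ _ _ hb hbeta _ _ _ _ bn
    (box_scaleE bl bu beta hbeta x) _ _ _ _ _ law1 ih.
  have [i2 E2] := expectation_truncated_gaussian _ _ _ hb hbeta _ _ _ _ bNn
    (box_scaleNE bl bu beta hbeta x) _ _ _ _ _ law2 ih.
  (* In the second term the minus sign in front cancels the one from [u2 - mu2], which is the
     opposite of the centred displacement. Both terms are values of [h] with the same mean, whence
     the division by [2 * beta]. *)
  pose h (y : 'rV[R]_n) := (c y - c x) * ((y ord0 i - x ord0 i) / beta - m).
  have estE w : ((2 * beta)^-1 *: ((c (x + beta *: u1 w) - c x) *: (u1 w - mu1) -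
      (c (x - beta *: u2 w) - c x) *: (u2 w - mu2))) ord0 i =
      (2 * beta)^-1 * (h (x + beta *: u1 w) + h (x + - beta *: u2 w)).
    rewrite /h u1E u2E scaleNr !mxE m1 m2; ring.
  have i12 : P.-integrable setT
      (fun w => (h (x + beta *: u1 w) + h (x + - beta *: u2 w))%:E).
    by under eq_fun do rewrite EFinD; exact: integrableD.
  split.
    under eq_fun do rewrite estE EFinM.
    exact: integrableZl.
  rewrite smE mxE unlock; under eq_integral do rewrite estE EFinM.
  rewrite integralZl//; under eq_integral do rewrite EFinD.
  rewrite integralD//; move: E1 E2; rewrite unlock => -> ->.
  by rewrite Eh -EFinD -EFinM; congr EFin; field; rewrite gt_eqF.
- by move=> L lip x Dx; rewrite smE; exact: box_mean_lipschitz.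
Qed.
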